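(* Let $\mathbb{K}$ be a d-minimal structure, expanding the ordered field $\overline{\mathbb{K}}$, and let $\mathcal{L}=(0,1,+,\cdot,<,\dots)$ be the language of $\mathbb{K}$. There exists a unique expansion of the Cauchy completion $\overline{\mathbb{K}}^C$ to an $\mathcal{L}$-structure $\mathbb{K}^C$ such that $\mathbb{K}$ is an elementary substructure of $\mathbb{K}^C$.
   Context: A first-order structure $\mathbb{K}$ expanding an ordered field is definably complete if every subset of $\mathbb{K}$ definable with parameters has a supremum in $\mathbb{K}\cup\{\pm\infty\}$. $\mathbb{K}$ is d-minimal if it is definably complete and, for every $\mathbb{K}'$ elementarily equivalent to $\mathbb{K}$, every subset of $\mathbb{K}'$ definable with parameters is the union of an open set and finitely many discrete sets. The Cauchy completion $\overline{\mathbb{K}}^C$ of an ordered field $\overline{\mathbb{K}}$ is the maximal linearly ordered group in which $\overline{\mathbb{K}}$ is dense; it is canonically an ordered field extending $\overline{\mathbb{K}}$ (in this setting a real closed field). Equivalently, it is the set of Cauchy sequences of length $\kappa$ in $\overline{\mathbb{K}}$ modulo null sequences, where $\kappa$ is the cofinality of $\overline{\mathbb{K}}$. *)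

(* Defs.v *)
From mathcomp Require Import all_boot all_order all_algebra.
From mathcomp Require Import all_classical all_reals all_analysis.

Set Implicit Arguments.
Unset Strict Implicit.
Unset Printing Implicit Defensive.

Import Order.TTheory GRing.Theory Num.Theory numFieldNormedType.Exports.

Local Open Scope classical_set_scope.
Local Open Scope ring_scope.

(* The symbols of a language (0, 1, +, *, <, ...) other than 0, 1, +, *, <,
   which are built into terms and formulas below.  Constant symbols are
   function symbols of arity 0. *)
Record language := Language {
  fsym : Type;
  farity : fsym -> nat;
  rsym : Type;
  rarity : rsym -> nat }.

(* Together with the ordered field structure of K, this is an L-structure
   expanding the ordered field K. *)
Record expansion (L : language) (K : Type) := Expansion {
  finterp : forall f : fsym L, ('I_(farity f) -> K) -> K;
  rinterp : forall r : rsym L, ('I_(rarity r) -> K) -> Prop }.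

(* The free variables of a term or formula of index n are indexed by 'I_n;
   the quantifier binds variable 0, and formulas of index 0 are sentences. *)
Inductive term (L : language) (n : nat) :=
| TVar of 'I_n
| TZero
| TOne
| TAdd of term L n & term L n
| TMul of term L n & term L n
| TFun (f : fsym L) of 'I_(farity f) -> term L n.

(* The remaining connectives and the universal quantifier are classically
   definable from these. *)
Inductive formula (L : language) (n : nat) :=
| FEq of term L n & term L n
| FLt of term L n & term L n
| FRel (r : rsym L) of 'I_(rarity r) -> term L n
| FNot of formula L n
| FAnd of formula L n & formula L n
| FEx of formula L n.+1.

Definition env_cons (K : Type) (n : nat) (x : K) (v : 'I_n -> K) :
    'I_n.+1 -> K :=
  fun i => if unlift ord0 i is Some j then v j else x.

Fixpoint eval (L : language) (K : realFieldType) (e : expansion L K)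
    (n : nat) (v : 'I_n -> K) (t : term L n) : K :=
  match t with
  | TVar i => v i
  | TZero => 0
  | TOne => 1
  | TAdd t1 t2 => eval e v t1 + eval e v t2
  | TMul t1 t2 => eval e v t1 * eval e v t2
  | TFun f ts => finterp e (fun i => eval e v (ts i))
  end.

Fixpoint sat (L : language) (K : realFieldType) (e : expansion L K)
    (n : nat) (v : 'I_n -> K) (phi : formula L n) {struct phi} : Prop :=
  match phi with
  | FEq t1 t2 => eval e v t1 = eval e v t2
  | FLt t1 t2 => eval e v t1 < eval e v t2
  | FRel r ts => rinterp e (fun i => eval e v (ts i))
  | FNot phi1 => ~ sat e v phi1
  | FAnd phi1 phi2 => sat e v phi1 /\ sat e v phi2
  | FEx phi1 => exists x : K, sat e (env_cons x v) phi1
  end.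

(* Definable with parameters: v lists the parameters. *)
Definition definable (L : language) (K : realFieldType) (e : expansion L K)
    (A : set K) : Prop :=
  exists (n : nat) (phi : formula L n.+1) (v : 'I_n -> K),
    A = [set x | sat e (env_cons x v) phi].

Definition elementarily_equivalent (L : language)
    (K K' : realFieldType) (e : expansion L K) (e' : expansion L K') : Prop :=
  forall (phi : formula L 0) (v : 'I_0 -> K) (v' : 'I_0 -> K'),
    sat e v phi <-> sat e' v' phi.

Definition elementary_embedding (L : language) (K K' : realFieldType)
    (e : expansion L K) (e' : expansion L K') (i : K -> K') : Prop :=
  forall (n : nat) (phi : formula L n) (v : 'I_n -> K),
    sat e v phi <-> sat e' (i \o v) phi.

Definition definably_complete (L : language) (K : realFieldType)
    (e : expansion L K) : Prop :=
  forall A : set K, definable e A ->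
    exists s : \bar K, supremums (EFin @` A) s.

Definition discrete_subset (T : topologicalType) (A : set T) : Prop :=
  A `<=` isolated A.

(* Every L-structure elementarily equivalent to (K, e) is again an expansion
   of an ordered field, so it is enough to let K' range over ordered fields.
   The topology of an ordered field is its order topology. *)
Definition d_minimal (L : language) (K : realFieldType)
    (e : expansion L K) : Prop :=
  definably_complete e /\
  forall (K' : realFieldType) (e' : expansion L K'),
    elementarily_equivalent e e' ->
    forall A : set K', definable e' A ->
      exists (U : set K') (n : nat) (D : 'I_n -> set K'),
        [/\ open U, (forall k, discrete_subset (D k))
          & A = U `|` \bigcup_k D k].

Definition linearly_ordered_group (G : porderZmodType) : Prop :=
  total (<=%R : rel G) /\
  forall x y z : G, x <= y -> z + x <= z + y.

Definition order_dense (T : Type) (G : porderZmodType) (j : T -> G) : Prop :=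
  forall x y : G, x < y -> exists a : T, x < j a < y.

(* The ordered field C, with the embedding i of K, is the Cauchy completion of
   K: the maximal linearly ordered group in which K is dense.  (An ordered
   group with a dense commutative subgroup is commutative, so only commutative
   groups need be considered.) *)
Definition is_cauchy_completion (K C : realFieldType)
    (i : {rmorphism K -> C}) : Prop :=
  [/\ {mono i : x y / x <= y},
      order_dense i
    & forall (G : porderZmodType) (j : {additive C -> G}),
        linearly_ordered_group G -> {mono j : x y / x <= y} ->
        order_dense (j \o i) ->
        forall g : G, exists c : C, j c = g].

(* Main.v *)
(* Let M be an elementary substructure of a d-minimal N and let c in N be a
   Cauchy cut over M which is not infinitely close to a point of M.  The
   boundary of a definable set is closed of finite Cantor-Bendixson rank, and a
   bounded closed discrete definable set has uniformly separated points, so an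
   M-definable boundary stays away from c unless c is in M.  Hence the type of c
   over M is determined by its cut.

   Uniqueness: take a maximal set M of the completion, containing K, on which
   the identity is elementary between two given expansions.  It is definably
   closed because K is dense, and by the above any c outside M could be added.

   Existence: let N be an ultrapower of K along small positive elements, in which
   every point of the completion is infinitely close to some point.  Definable
   functions are locally bounded and have small oscillation somewhere on every
   interval, by a definable Baire property, so adjoining a Cauchy cut c to M and
   closing under definable choice creates neither new infinitesimals nor points
   that K does not approximate.  A maximal M in which K is dense is then
   isomorphic, as an ordered group, to the completion.

   The Baire property: a definable increasing family of sets without interior
   has uniformly bounded rank, by d-minimality of an ultrapower, and so reduces
   to a family of sets without limit points covering an interval.  Ordering the
   points by their entrance into the family, the set of points whose nearest
   predecessor on the left precedes the one on the right would be dense and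
   codense, which d-minimality forbids. *)

From HB Require Import structures.
From mathcomp Require Import all_boot all_order all_algebra.
From mathcomp Require Import all_classical all_reals all_analysis.
From mathcomp Require Import ring lra.
Require Import Defs.

Set Implicit Arguments.
Unset Strict Implicit.
Unset Printing Implicit Defensive.

Import Order.TTheory GRing.Theory Num.Theory numFieldNormedType.Exports.

Local Open Scope classical_set_scope.
Local Open Scope ring_scope.

(** * Definability *)

Section Renaming.
Variable L : language.

Lemma env_cons0 (K : Type) n (x : K) (v : 'I_n -> K) : env_cons x v ord0 = x.
Proof. by rewrite /env_cons unlift_none. Qed.

Lemma env_consS (K : Type) n (x : K) (v : 'I_n -> K) j :
  env_cons x v (lift ord0 j) = v j.
Proof. by rewrite /env_cons liftK. Qed.

Fixpoint trename n m (s : 'I_n -> 'I_m) (t : term L n) : term L m :=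
  match t with
  | TVar i => TVar L (s i)
  | TZero => TZero L m
  | TOne => TOne L m
  | TAdd t1 t2 => TAdd (trename s t1) (trename s t2)
  | TMul t1 t2 => TMul (trename s t1) (trename s t2)
  | TFun f ts => @TFun L m f (fun i => trename s (ts i))
  end.

Definition slift n m (s : 'I_n -> 'I_m) : 'I_n.+1 -> 'I_m.+1 :=
  env_cons ord0 (lift ord0 \o s).

Fixpoint frename n (phi : formula L n) :
    forall m, ('I_n -> 'I_m) -> formula L m :=
  match phi with
  | FEq t1 t2 => fun m s => FEq (trename s t1) (trename s t2)
  | FLt t1 t2 => fun m s => FLt (trename s t1) (trename s t2)
  | FRel r ts => fun m s => @FRel L m r (fun i => trename s (ts i))
  | FNot phi1 => fun m s => FNot (frename phi1 s)
  | FAnd phi1 phi2 => fun m s => FAnd (frename phi1 s) (frename phi2 s)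
  | FEx phi1 => fun m s => FEx (frename phi1 (slift s))
  end.

Variables (K : realFieldType).

Lemma eval_rename (e : expansion L K) n m (s : 'I_n -> 'I_m) v (t : term L n) :
  eval e v (trename s t) = eval e (v \o s) t.
Proof.
elim: t => //= [t1 -> t2 -> //|t1 -> t2 -> //|f ts IH].
by congr finterp; apply/funext.
Qed.

Lemma env_cons_slift n m (s : 'I_n -> 'I_m) (x : K) v :
  env_cons x v \o slift s = env_cons x (v \o s).
Proof.
apply/funext => i; rewrite /comp /slift.
by case: (unliftP ord0 i) => [j|] ->; rewrite !(env_cons0, env_consS).
Qed.

Lemma sat_rename (e : expansion L K) n (phi : formula L n) :
  forall m (s : 'I_n -> 'I_m) v, sat e v (frename phi s) = sat e (v \o s) phi.
Proof.
elim: n / phi => [n t1 t2|n t1 t2|n r ts|n phi IH|n phi1 IH1 phi2 IH2|n phi IH] m s v /=.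
- by rewrite !eval_rename.
- by rewrite !eval_rename.
- by congr rinterp; apply/funext => i; rewrite eval_rename.
- by rewrite IH.
- by rewrite IH1 IH2.
- by congr ex; apply/funext => x; rewrite IH env_cons_slift.
Qed.

End Renaming.

(* A formula in which each variable is instantiated by a de Bruijn index into
   an infinite environment or by the name of a parameter. *)
Record pform (L : language) (T : Type) :=
  PForm { psize : nat; pbody : formula L psize; passign : 'I_psize -> nat + T }.

Definition scons (K : Type) (x : K) (v : nat -> K) : nat -> K :=
  fun k => if k is k'.+1 then v k' else x.

Definition look (T K : Type) (j : T -> K) (v : nat -> K) (s : nat + T) : K :=
  match s with inl k => v k | inr a => j a end.

Definition psat (L : language) (T : Type) (K : realFieldType)
    (e : expansion L K) (j : T -> K) (p : pform L T) (v : nat -> K) : Prop :=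
  sat e (look j v \o @passign _ _ p) (pbody p).

Definition params_in (L : language) (T : Type) (X : set T) (p : pform L T) :=
  forall i a, @passign _ _ p i = inr a -> X a.

Section PForm.
Variables (L : language) (T : Type).
Implicit Types (p q : pform L T) (X : set T).

Definition pnot p := PForm (FNot (pbody p)) (@passign _ _ p).

Definition pand p q :=
  PForm (FAnd (frename (pbody p) (lshift (psize q)))
              (frename (pbody q) (@rshift (psize p) (psize q))))
        (fun i => match fintype.split i with
                  | inl j => @passign _ _ p j | inr j => @passign _ _ q j end).

(** All positions assigned index 0 merge into the bound variable and the other indices drop by one;
    what [passign] then gives the merged positions is a dummy value. *)
Definition pex p :=
  PForm (FEx (frename (pbody p)
           (fun i => if @passign _ _ p i is inl 0%N then ord0 else lift ord0 i)))
        (fun i => match @passign _ _ p i with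
                  | inl k => inl k.-1 | inr a => inr a end).

Definition psubst (s : nat -> nat + T) p :=
  PForm (pbody p) (fun i => match @passign _ _ p i with
                            | inl k => s k | inr a => inr a end).

Definition pat2 (phi : formula L 2) (s1 s2 : nat + T) :=
  PForm phi (fun i => if val i == 0%N then s1 else s2).

Definition pat3 (phi : formula L 3) (s1 s2 s3 : nat + T) :=
  PForm phi (fun i => if val i == 0%N then s1 else if val i == 1%N then s2 else s3).

Definition plt := pat2 (FLt (TVar L ord0) (TVar L ord_max)).
Definition padd := pat3
  (FEq (TAdd (TVar L ord0) (TVar L (inord 1))) (TVar L ord_max)).
Definition pmul := pat3
  (FEq (TMul (TVar L ord0) (TVar L (inord 1))) (TVar L ord_max)).

Variables (K : realFieldType) (e : expansion L K) (j : T -> K).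
Implicit Type v : nat -> K.

Lemma psat_not p v : psat e j (pnot p) v = ~ psat e j p v.
Proof. by []. Qed.

Lemma psat_and p q v : psat e j (pand p q) v = (psat e j p v /\ psat e j q v).
Proof.
rewrite /psat /= !sat_rename; congr and; congr sat.
  by apply/funext => i /=; rewrite -[lshift _ i]/(unsplit (inl i)) unsplitK.
by apply/funext => i /=; rewrite -[rshift _ i]/(unsplit (inr i)) unsplitK.
Qed.

Lemma psat_ex p v : psat e j (pex p) v = exists x, psat e j p (scons x v).
Proof.
rewrite /psat /=; congr ex; apply/funext => x; rewrite sat_rename.
congr sat; apply/funext => i /=.
by case E: passign => [[|k]|a]; rewrite ?env_cons0 ?env_consS //= E.
Qed.

Lemma psat_subst s p v : psat e j (psubst s p) v = psat e j p (look j v \o s).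
Proof.
by rewrite /psat /=; congr sat; apply/funext => i /=; case: passign.
Qed.

Lemma psat_lt s1 s2 v : psat e j (plt s1 s2) v = (look j v s1 < look j v s2).
Proof. by []. Qed.

Lemma psat_add s1 s2 s3 v :
  psat e j (padd s1 s2 s3) v = (look j v s1 + look j v s2 = look j v s3).
Proof. by rewrite /psat /= inordK. Qed.

Lemma psat_mul s1 s2 s3 v :
  psat e j (pmul s1 s2 s3) v = (look j v s1 * look j v s2 = look j v s3).
Proof. by rewrite /psat /= inordK. Qed.

Lemma params_and X p q :
  params_in X p -> params_in X q -> params_in X (pand p q).
Proof. by move=> hp hq i a /=; case: fintype.split => k; [apply: hp|apply: hq]. Qed.

Lemma params_ex X p : params_in X p -> params_in X (pex p).
Proof. by move=> hp i a /=; case E: passign => [k|b] // [<-]; apply: hp E. Qed.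

Lemma params_subst X s p : params_in X p ->
  (forall k a, s k = inr a -> X a) -> params_in X (psubst s p).
Proof.
move=> hp hs i a /=; case E: passign => [k|b]; first exact: hs.
by move=> [<-]; apply: hp E.
Qed.

Definition lookX X (s : nat + T) := forall a, s = inr a -> X a.

Lemma params_at2 X phi s1 s2 :
  lookX X s1 -> lookX X s2 -> params_in X (pat2 phi s1 s2).
Proof. by move=> h1 h2 i a /=; case: ifP => _; auto. Qed.

Lemma params_at3 X phi s1 s2 s3 :
  lookX X s1 -> lookX X s2 -> lookX X s3 -> params_in X (pat3 phi s1 s2 s3).
Proof. by move=> h1 h2 h3 i a /=; do 2?case: ifP => _; auto. Qed.

End PForm.

(** Definability over [X] is a property of predicates on environments, so that closure lemmas
    replace the writing of formulas. *)
Definition Df (L : language) (K : realFieldType) (e : expansion L K)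
    (X : set K) (P : (nat -> K) -> Prop) : Prop :=
  exists2 p : pform L K, params_in X p & forall v, P v <-> psat e id p v.

(** A function with definable graph: the value sits at index 0 and the arguments are shifted by
    one. *)
Definition Dt (L : language) (K : realFieldType) (e : expansion L K)
    (X : set K) (t : (nat -> K) -> K) : Prop :=
  Df e X (fun v => v 0%N = t (fun k => v k.+1)).

Definition Dset (L : language) (K : realFieldType) (e : expansion L K)
    (X : set K) (A : set K) : Prop := Df e X (fun v => A (v 0%N)).

Definition Drel (L : language) (K : realFieldType) (e : expansion L K)
    (X : set K) (R : K -> K -> Prop) : Prop :=
  Df e X (fun v => R (v 0%N) (v 1%N)).

Section Df.
Variables (L : language) (K : realFieldType) (e : expansion L K).
Implicit Types (X Y : set K) (P Q : (nat -> K) -> Prop) (s t : (nat -> K) -> K).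

Lemma Df_ext X P Q : (forall v, P v <-> Q v) -> Df e X P -> Df e X Q.
Proof.
by move=> PQ [p pX Pp]; exists p => // v; rewrite -PQ.
Qed.

Lemma DfS X Y P : X `<=` Y -> Df e X P -> Df e Y P.
Proof. by move=> XY [p pX Pp]; exists p => // i a /pX/XY. Qed.

Lemma DfNot X P : Df e X P -> Df e X (fun v => ~ P v).
Proof. by move=> [p pX Pp]; exists (pnot p) => // v; rewrite psat_not Pp. Qed.

Lemma DfAnd X P Q : Df e X P -> Df e X Q -> Df e X (fun v => P v /\ Q v).
Proof.
move=> [p pX Pp] [q qX Qq]; exists (pand p q); first exact: params_and.
by move=> v; rewrite psat_and Pp Qq.
Qed.

Lemma DfOr X P Q : Df e X P -> Df e X Q -> Df e X (fun v => P v \/ Q v).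
Proof.
move=> hP hQ; apply: Df_ext (DfNot (DfAnd (DfNot hP) (DfNot hQ))) => v.
by rewrite not_andE !notK.
Qed.

Lemma DfImp X P Q : Df e X P -> Df e X Q -> Df e X (fun v => P v -> Q v).
Proof.
move=> hP hQ; apply: Df_ext (DfOr (DfNot hP) hQ) => v.
by rewrite implyE.
Qed.

Lemma DfIff X P Q : Df e X P -> Df e X Q -> Df e X (fun v => P v <-> Q v).
Proof. by move=> hP hQ; apply: DfAnd; apply: DfImp. Qed.

Lemma scons_eta (v : nat -> K) : scons (v 0%N) (fun k => v k.+1) = v.
Proof. by apply/funext => -[]. Qed.

Lemma DfEx X (P : K -> (nat -> K) -> Prop) :
  Df e X (fun v => P (v 0%N) (fun k => v k.+1)) ->
  Df e X (fun v => exists x, P x v).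
Proof.
move=> [p pX Pp]; exists (pex p); first exact: params_ex.
by move=> v; rewrite psat_ex; split=> -[x h]; exists x; apply/(Pp (scons x v)).
Qed.

Lemma DfAll X (P : K -> (nat -> K) -> Prop) :
  Df e X (fun v => P (v 0%N) (fun k => v k.+1)) ->
  Df e X (fun v => forall x, P x v).
Proof.
move=> hP; apply: Df_ext (DfNot (DfEx (P := fun x v => ~ P x v) (DfNot hP))) => v.
split=> [H x|H [x] h]; last exact: h (H x).
by apply: contrapT => h; apply: H; exists x.
Qed.

Lemma Df_rename X (s : nat -> nat) P :
  Df e X P -> Df e X (fun v => P (v \o s)).
Proof.
move=> [p pX Pp]; exists (psubst (fun k => inl (s k)) p); first exact: params_subst.
by move=> v; rewrite psat_subst Pp.
Qed.

Lemma DfSub X P t : Dt e X t -> Df e X P -> Df e X (fun v => P (scons (t v) v)).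
Proof.
move=> ht hP.
apply: Df_ext (DfEx (P := fun x v => x = t v /\ P (scons x v)) _) => [v|].
  by split=> [[x [-> ?]] //|?]; exists (t v).
by apply: DfAnd => //; apply: Df_ext hP => v; rewrite scons_eta.
Qed.

Lemma Df_app1 X (A : set K) t :
  Dset e X A -> Dt e X t -> Df e X (fun v => A (t v)).
Proof. by move=> hA ht; apply: (DfSub ht hA). Qed.

Lemma Dt_shift X t : Dt e X t -> Dt e X (fun v => t (fun k => v k.+1)).
Proof.
by move=> /(Df_rename (fun k => if k is k'.+1 then k'.+2 else 0%N)).
Qed.

Lemma Df_app2 X (R : K -> K -> Prop) s t :
  Drel e X R -> Dt e X s -> Dt e X t -> Df e X (fun v => R (s v) (t v)).
Proof.
move=> hR hs ht; apply: (DfSub (P := fun v => R (s (fun k => v k.+1)) (v 0%N)) ht).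
have hR' : Df e X (fun v => R (v 0%N) (v 1%N)) by [].
by have := DfSub (Dt_shift hs) hR'.
Qed.

Definition D3 X (R : K -> K -> K -> Prop) := Df e X (fun v => R (v 0%N) (v 1%N) (v 2%N)).

Lemma Df_app3 X (R : K -> K -> K -> Prop) r s t :
  D3 X R -> Dt e X r -> Dt e X s -> Dt e X t ->
  Df e X (fun v => R (r v) (s v) (t v)).
Proof.
move=> hR hr hs ht.
apply: (DfSub (P := fun v => R (r (fun k => v k.+1)) (s (fun k => v k.+1)) (v 0%N)) ht).
apply: (DfSub (P := fun v => R (r (fun k => v k.+2)) (v 0%N) (v 1%N)) (Dt_shift hs)).
by have := DfSub (Dt_shift (Dt_shift hr)) hR.
Qed.

Lemma Df_lt01 X : Drel e X (fun x y => x < y).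
Proof. by exists (plt L (inl 0%N) (inl 1%N)) => //; apply: params_at2. Qed.

Lemma DfLt X s t : Dt e X s -> Dt e X t -> Df e X (fun v => s v < t v).
Proof. exact: Df_app2 (Df_lt01 X). Qed.

Lemma DfLe X s t : Dt e X s -> Dt e X t -> Df e X (fun v => s v <= t v).
Proof.
move=> hs ht; apply: Df_ext (DfNot (DfLt ht hs)) => v.
by split=> [/negP|h]; [rewrite -leNgt|apply/negP; rewrite -leNgt].
Qed.

Lemma DfEq X s t : Dt e X s -> Dt e X t -> Df e X (fun v => s v = t v).
Proof.
move=> hs ht; apply: Df_ext (DfAnd (DfLe hs ht) (DfLe ht hs)) => v.
by split=> [[h1 h2]|->//]; apply: le_anti; rewrite h1 h2.
Qed.

Lemma Df_eq01 X : Drel e X (fun x y => x = y).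
Proof.
apply: (Df_ext (P := fun v : nat -> K => ~ (v 0%N < v 1%N) /\ ~ (v 1%N < v 0%N))).
  move=> v; split=> [[/negP + /negP]|->]; last by rewrite ltxx.
  by case: ltgtP.
apply: DfAnd; apply: DfNot; first exact: Df_lt01.
by apply: (Df_rename (fun k => if k is 0%N then 1%N else 0%N) (Df_lt01 X)).
Qed.

Lemma DtVar X k : Dt e X (fun v => v k).
Proof.
exact: (Df_rename (fun j => if j is 0%N then 0%N else k.+1) (Df_eq01 X)).
Qed.

Lemma DtCst X a : X a -> Dt e X (fun=> a).
Proof.
move=> Xa; have [p pX Pp] := Df_eq01 X.
exists (psubst (fun k => if k is 0%N then inl 0%N else inr a) p).
  by apply: params_subst => // -[|k] b //= [<-].
by move=> v; rewrite psat_subst -Pp.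
Qed.

Lemma D3_add X : D3 X (fun x y z => x = y + z).
Proof.
exists (padd L (inl 1%N) (inl 2%N) (inl 0%N)); first exact: params_at3.
by move=> v; rewrite psat_add /=; split.
Qed.

Lemma D3_mul X : D3 X (fun x y z => x = y * z).
Proof.
exists (pmul L (inl 1%N) (inl 2%N) (inl 0%N)); first exact: params_at3.
by move=> v; rewrite psat_mul /=; split.
Qed.

Lemma DtAdd X s t : Dt e X s -> Dt e X t -> Dt e X (fun v => s v + t v).
Proof.
by move=> hs ht; apply: (Df_app3 (D3_add X) (DtVar X 0) (Dt_shift hs) (Dt_shift ht)).
Qed.

Lemma DtMul X s t : Dt e X s -> Dt e X t -> Dt e X (fun v => s v * t v).
Proof.
by move=> hs ht; apply: (Df_app3 (D3_mul X) (DtVar X 0) (Dt_shift hs) (Dt_shift ht)).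
Qed.

Lemma Dt0 X : Dt e X (fun=> 0).
Proof.
apply: (Df_ext (P := fun v : nat -> K => v 0%N + v 0%N = v 0%N)) => [v|].
  by split=> [h|->]; [apply: (addIr (v 0%N)); rewrite h add0r|rewrite addr0].
by apply: DfEq; [apply: DtAdd; apply: DtVar|apply: DtVar].
Qed.

Lemma Dt1 X : Dt e X (fun=> 1).
Proof.
apply: (Df_ext (P := fun v : nat -> K => v 0%N * v 0%N = v 0%N /\ 0 < v 0%N)) => [v|].
  split=> [[h v0]|->]; last by rewrite mulr1 ltr01.
  by apply: (mulfI (lt0r_neq0 v0)); rewrite h mulr1.
apply: DfAnd; first by apply: DfEq; [apply: DtMul; apply: DtVar|apply: DtVar].
by apply: DfLt; [apply: Dt0|apply: DtVar].
Qed.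

Lemma DtOpp X t : Dt e X t -> Dt e X (fun v => - t v).
Proof.
move=> ht; apply: (Df_ext (P := fun v => t (fun k => v k.+1) + v 0%N = 0)) => [v|].
  by split=> [/eqP|->]; [rewrite addrC addr_eq0 => /eqP|rewrite addrN].
by apply: DfEq; [apply: DtAdd; [apply: Dt_shift|apply: DtVar]|apply: Dt0].
Qed.

Lemma DtNat X n : Dt e X (fun=> n%:R).
Proof.
elim: n => [|n IH]; first exact: Dt0.
by under [fun _ => _]eq_fun do rewrite -natr1; apply: DtAdd => //; apply: Dt1.
Qed.

Lemma DtInv X t : Dt e X t -> Dt e X (fun v => (t v)^-1).
Proof.
move=> ht; apply: (Df_ext (P := fun v => (t (fun k => v k.+1) = 0 /\ v 0%N = 0)
  \/ t (fun k => v k.+1) * v 0%N = 1)) => [v|].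
  case: (eqVneq (t (fun k => v k.+1)) 0) => [->|n0].
    by rewrite invr0 mul0r; split=> [[[]|/eqP]//|]; [rewrite eq_sym oner_eq0|left].
  split=> [[[h]|h]|->]; first by rewrite h eqxx in n0.
    by rewrite -[RHS]mulr1 -h mulKf.
  by right; rewrite divff.
apply: DfOr; last first.
  by apply: DfEq; [apply: DtMul; [apply: Dt_shift|apply: DtVar]|apply: Dt1].
by apply: DfAnd; (apply: DfEq; last exact: Dt0); [apply: Dt_shift|apply: DtVar].
Qed.

Lemma DtAbs X t : Dt e X t -> Dt e X (fun v => `|t v|).
Proof.
move=> ht.
apply: (Df_ext (P := fun v => (0 <= t (fun k => v k.+1) /\ v 0%N = t (fun k => v k.+1))
  \/ (t (fun k => v k.+1) < 0 /\ v 0%N = - t (fun k => v k.+1)))) => [v|].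
  case: (leP 0 (t (fun k => v k.+1))) => h.
    by rewrite ger0_norm //; split=> [[[]|[]]|->]; auto.
  by rewrite ltr0_norm //; split=> [[[]|[]]|->]; auto.
have ht' := Dt_shift ht; have hv := DtVar X 0; have h0 := Dt0 X.
by apply: DfOr; apply: DfAnd; [exact: DfLe|exact: DfEq|exact: DfLt|apply: DfEq => //; apply: DtOpp].
Qed.

Lemma definable_Dset (A : set K) : definable e A <-> Dset e setT A.
Proof.
split=> [[n [phi [v ->]]]|[p _ Pp]].
  exists (PForm phi (env_cons (inl 0%N) (fun j => inr (v j)))) => // w.
  rewrite /psat /=; suff -> : look id w \o env_cons (inl 0%N) (fun j => inr (v j))
    = env_cons (w 0%N) v by [].
  apply/funext => i /=.
  by case: (unliftP ord0 i) => [j|] ->; rewrite !(env_cons0, env_consS).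
exists (psize p), (frename (pbody p)
  (fun i => if @passign _ _ p i is inl 0%N then ord0 else lift ord0 i)).
(* Membership in [A] depends on variable 0 alone, so the other variables can be frozen at 0. *)
exists (look id (fun=> 0) \o @passign _ _ p); apply/seteqP.
have E x : sat e (env_cons x (look id (fun=> 0) \o @passign _ _ p)) (frename (pbody p)
  (fun i => if @passign _ _ p i is inl 0%N then ord0 else lift ord0 i))
  = psat e id p (scons x (fun=> 0)).
  rewrite sat_rename /psat; congr sat; apply/funext => i /=.
  by case E: passign => [[|k]|a]; rewrite ?env_cons0 ?env_consS //= E.
by split=> x /=; rewrite E -(Pp (scons x (fun=> 0))).
Qed.

End Df.

(** Follows the syntax of the predicate. Implications and universal quantifiers are both products,
    so they share the last case. *)
Ltac df_step :=
  cbv beta;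
  lazymatch goal with
  | |- Df _ _ (fun v => _ /\ _) => apply: DfAnd
  | |- Df _ _ (fun v => _ \/ _) => apply: DfOr
  | |- Df _ _ (fun v => _ <-> _) => apply: DfIff
  | |- Df _ _ (fun v => ~ _) => apply: DfNot
  | |- Df _ _ (fun v => exists x, _) => apply: DfEx
  | |- Df _ _ (fun v => is_true (_ < _)) => apply: DfLt
  | |- Df _ _ (fun v => is_true (_ <= _)) => apply: DfLe
  | |- Df _ _ (fun v => _ = _) => apply: DfEq
  | |- Dt _ _ (fun v => v _) => exact: DtVar
  | |- Dt _ _ (fun v => 0) => exact: Dt0
  | |- Dt _ _ (fun v => 1) => exact: Dt1
  | |- Dt _ _ (fun v => _%:R) => exact: DtNat
  | |- Dt _ _ (fun v => _ + _) => apply: DtAdd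
  | |- Dt _ _ (fun v => _ * _) => apply: DtMul
  | |- Dt _ _ (fun v => - _) => apply: DtOpp
  | |- Dt _ _ (fun v => `|_|) => apply: DtAbs
  | |- Dt _ _ (fun v => _^-1) => apply: DtInv
  | |- Dt _ _ (fun v => _) => apply: DtCst; first [assumption | exact: I]
  | H : Dset ?e ?X ?A |- Df ?e ?X (fun v => ?A _) => apply: (Df_app1 H)
  | H : Drel ?e ?X ?A |- Df ?e ?X (fun v => ?A _ _) => apply: (Df_app2 H)
  | H : D3 ?e ?X ?A |- Df ?e ?X (fun v => ?A _ _ _) => apply: (Df_app3 H)
  | _ => first [apply: DfImp | apply: DfAll]
  end.

Ltac df := rewrite ?/Dset ?/Drel ?/D3 /=; repeat df_step.

(** Serves Zorn's lemma: the parameters of a formula are finite in number, so those taken from the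
    union of a chain lie in one member. *)
Lemma chain_seq (T : eqType) (F : set (set T)) (s : seq T) :
  (exists X, F X) -> total_on F subset ->
  (forall a, a \in s -> (\bigcup_(X in F) X) a) ->
  exists2 X, F X & forall a, a \in s -> X a.
Proof.
move=> [X0 FX0] tF; elim: s => [|c s IH] sX; first by exists X0.
case: IH => [a sa|X FX Xs]; first by apply: sX; rewrite inE sa orbT.
have [Y FY Yc] : (\bigcup_(X in F) X) c by apply: sX; rewrite inE eqxx.
case: (tF _ _ FX FY) => XY.
  by exists Y => // a; rewrite inE => /orP[/eqP->|/Xs/XY].
by exists X => // a; rewrite inE => /orP[/eqP->|/Xs]; auto.
Qed.

(** * Definable closure and elimination of parameters *)

Section DefinableClosure.
Variables (L : language) (K : realFieldType) (e : expansion L K).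
Implicit Types (X : set K) (P : (nat -> K) -> Prop).

Definition dcl X : set K := [set y | Dset e X [set x | x = y]].

(** Each occurrence of the parameter [c] becomes a fresh variable 0, the old variables being
    shifted. *)
Lemma Df_param X c P : Df e (X `|` [set c]) P ->
  exists2 Q, Df e X Q & forall v, P v <-> Q (scons c v).
Proof.
move=> [p pX Pp].
pose q := PForm (pbody p) (fun i => match @passign _ _ p i with
  | inl k => inl k.+1
  | inr a => if pselect (a = c) then inl 0%N else inr a end).
exists (psat e id q); first exists q => //.
  move=> i a /=; case E: passign => [k|b] //.
  by case: pselect => // bc [<-]; case: (pX _ _ E).
move=> v; rewrite Pp /psat /=.
suff -> : look id v \o @passign _ _ p = look id (scons c v) \o @passign _ _ q by [].
by apply/funext => i /=; case: passign => [k|a] //; case: pselect.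
Qed.

Lemma Dset_param X c (A : set K) : Dset e (X `|` [set c]) A ->
  exists2 R : K -> K -> Prop, Drel e X R & forall x, A x <-> R c x.
Proof.
move=> /Df_param[Q dQ AQ]; exists (fun x z => Q (scons x (fun=> z))).
  apply: Df_ext (Df_rename (fun k => if k is 0%N then 0%N else 1%N) dQ) => v.
  by rewrite (_ : _ \o _ = scons (v 0%N) (fun=> v 1%N)) //; apply/funext => -[].
by move=> x; rewrite -AQ.
Qed.

Lemma sub_dcl X : X `<=` dcl X.
Proof. by move=> y Xy; rewrite /dcl /=; df. Qed.

Lemma dcl_mem X (A : set K) y : Dset e X A -> A y ->
  (forall z, A z -> z = y) -> dcl X y.
Proof. by move=> dA Ay Au; apply: Df_ext dA => v; split=> [/Au|->]. Qed.

(** The parameter is quantified away as the unique solution of its own definition over [X]. *)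
Lemma Df_dcl1 X c P : dcl X c -> Df e (X `|` [set c]) P -> Df e X P.
Proof.
move=> dc /Df_param[Q dQ PQ].
apply: (Df_ext (P := fun v => exists z, z = c /\ Q (scons z v))).
  by move=> v; rewrite PQ; split=> [[z [->]]|] //; exists c.
apply: DfEx; apply: DfAnd; first exact: dc.
by apply: Df_ext dQ => v; rewrite scons_eta.
Qed.

Lemma Df_finite X P : Df e X P ->
  exists2 s : seq K, (forall a, a \in s -> X a) & Df e [set` s] P.
Proof.
move=> [p pX Pp].
exists (pmap (fun i => match @passign _ _ p i with inr a => Some a | _ => None end)
             (enum 'I_(psize p))).
  move=> a; rewrite mem_pmap => /mapP[i _].
  by case E: passign => [k|b] // [->]; apply: pX E.
exists p => // i a E /=; rewrite mem_pmap; apply/mapP; exists i; first by rewrite mem_enum.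
by rewrite E.
Qed.

(** Only finitely many parameters occur, and they are eliminated one at a time. *)
Lemma Df_dcl X P : Df e (dcl X) P -> Df e X P.
Proof.
move=> /Df_finite[s sX dP].
have {dP} : Df e (X `|` [set` s]) P by apply: DfS dP => x; right.
elim: s sX => [|c s IH] sX; first by apply: DfS => x [].
move=> dP; apply: IH => [a sa|]; first by apply: sX; rewrite inE sa orbT.
apply: (@Df_dcl1 _ c); first by apply: DfS (sX c _); [left|rewrite inE eqxx].
apply: DfS dP => x [|] /=; first by left; left.
by rewrite inE => /orP[/eqP->|]; [right|left; right].
Qed.

Lemma Df_chain (F : set (set K)) P : (exists X, F X) -> total_on F subset ->
  Df e (\bigcup_(X in F) X) P -> exists2 X, F X & Df e X P.
Proof.
move=> nF tF /Df_finite[s sX dP]; have [X FX Xs] := chain_seq nF tF sX.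
by exists X => //; apply: DfS dP.
Qed.

End DefinableClosure.

(** * Cantor-Bendixson rank *)

Section Rank.
Variable K : realFieldType.
Implicit Types (A : set K) (x d : K).

(** The Cantor-Bendixson derivative, taken within [A]: limit points outside [A] are not added. *)
Definition drv A : set K :=
  [set x | A x /\ forall d, 0 < d -> exists y, [/\ A y, y <> x & `|y - x| < d]].

Definition cl A : set K :=
  [set x | forall d, 0 < d -> exists2 y, A y & `|y - x| < d].

Definition closed_set A := cl A `<=` A.

Definition no_interior A a b :=
  forall p q, a <= p -> p < q -> q <= b -> exists x, [/\ p < x, x < q & ~ A x].

Lemma drv_sub A : drv A `<=` A. Proof. by move=> x []. Qed.

Lemma sub_drv A B : A `<=` B -> drv A `<=` drv B.
Proof.
move=> AB x [Ax h]; split; first exact: AB.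
by move=> d /h[y [Ay yx yd]]; exists y; split=> //; apply: AB.
Qed.

Lemma iter_drv_sub k A : iter k drv A `<=` A.
Proof. by elim: k => //= k IH x /drv_sub/IH. Qed.

Lemma cl_closed A : closed_set (cl A).
Proof.
move=> x clx d d0; have d2 : 0 < d / 2 by lra.
have [y /(_ _ d2)[z Az zy] yx] := clx _ d2; exists z => //.
by rewrite -(subrKA y); apply: le_lt_trans (ler_normD _ _) _; lra.
Qed.

Lemma sub_cl A : A `<=` cl A.
Proof. by move=> x Ax d d0; exists x; rewrite ?subrr ?normr0. Qed.

Lemma drv_closed A : closed_set A -> closed_set (drv A).
Proof.
move=> cA x clx; split; first by apply: cA => d /clx[y [Ay _]]; exists y.
move=> d d0; have d2 : 0 < d / 2 by lra.
have [y [Ay hy] yx] := clx _ d2.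
have [xy|/eqP nyx] := eqVneq y x.
  by have [z [Az zy zd]] := hy _ d0; exists z; rewrite -xy.
by exists y; split=> //; lra.
Qed.

(** Without isolated points [A] would be contained in its derivative and survive every iteration. *)
Lemma rank_isolated k A : (exists x, A x) -> iter k drv A `<=` set0 ->
  exists x d, [/\ A x, 0 < d & forall y, A y -> `|y - x| < d -> y = x].
Proof.
move=> [x0 Ax0] rk; apply: contrapT => noiso.
suff drvA : A `<=` drv A.
  have : A `<=` iter k drv A.
    by elim: k {rk} => //= k IH x /drvA; apply: sub_drv.
  by move=> /(_ _ Ax0)/rk.
move=> x Ax; split=> // d d0; apply: contrapT => h; apply: noiso.
exists x, d; split=> // y Ay yx; apply: contrapT => nyx; apply: h.
by exists y.
Qed.

(* Points of the j-th derivative are limits of more than j of the discrete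
   sets. *)
Lemma discrete_union_rank n (D : 'I_n -> set K) :
  (forall k x, D k x -> exists2 d, 0 < d & forall y, D k y -> `|y - x| < d -> y = x) ->
  iter n drv (\bigcup_k D k) `<=` set0.
Proof.
move=> dD; pose meet (V : set K) : {set 'I_n} := finset (fun k => `[< exists2 y, V y & D k y >]).
have key j (V : set K) x : (forall y, V y -> exists2 d, 0 < d &
    forall z, `|z - y| < d -> V z) -> V x -> iter j drv (\bigcup_k D k) x ->
    (j < #|meet V|)%N.
  elim: j V x => [|j IH] V x oV Vx /=.
    by move=> [k _ Dx]; rewrite card_gt0; apply/set0Pn; exists k; rewrite finset.in_set;
      apply/asboolP; exists x.
  move=> [jx hx]; have [k _ Dkx] := iter_drv_sub jx.
  have [d d0 dk] := dD _ _ Dkx; have [d' d'0 dV] := oV _ Vx.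
  pose d1 := Num.min d d'.
  have d10 : 0 < d1 by rewrite lt_min d0.
  have [y [jy yx yd]] := hx _ d10.
  (* A punctured ball inside [V], small enough to miss [D k]: passing from [V] to [W] loses the
     index [k]. *)
  pose W := [set z | z <> x /\ `|z - x| < d1].
  have := IH W y _ (conj yx yd) jy.
  move=> h; apply: leq_trans (proper_card _); first apply: (h _).
    move=> z [zx zd]; exists (Num.min (`|z - x|) (d1 - `|z - x|)).
      by rewrite lt_min subr_gt0 zd normr_gt0 subr_eq0; apply/andP; split=> //; apply/eqP.
    move=> w; rewrite lt_min => /andP[w1 w2]; split.
      by move=> wx; move: w1; rewrite wx distrC ltxx.
    rewrite -(subrKA z); apply: le_lt_trans (ler_normD _ _) _; lra.
  apply/properP; split.
    apply/fintype.subsetP => i; rewrite !finset.in_set => /asboolP[z [zx zd] Dz]; apply/asboolP.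
    by exists z => //; apply: dV; apply: lt_le_trans zd _; rewrite ge_min lexx orbT.
  exists k; first by rewrite finset.in_set; apply/asboolP; exists x.
  rewrite finset.in_set; apply/negP => /asboolP[z [zx zd] Dz]; apply: zx; apply: dk => //.
  by apply: lt_le_trans zd _; rewrite ge_min lexx.
move=> x hx; have := key n setT x _ I hx.
rewrite ltnNge (leq_trans (max_card _)) ?card_ord // => /(_ _)/negP; apply => //.
by move=> y _; exists 1.
Qed.

End Rank.

(** * Completeness and finite rank as consequences of d-minimality *)

Definition lub_property (L : language) (K : realFieldType) (e : expansion L K) :=
  forall A : set K, Dset e setT A -> (exists x, A x) ->
    (exists b, forall x, A x -> x <= b) ->
    exists2 s, forall x, A x -> x <= s & forall t, (forall x, A x -> x <= t) -> s <= t.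

(** The form in which d-minimality is used; it concerns one structure at a time. *)
Definition finite_rank (L : language) (K : realFieldType) (e : expansion L K) :=
  forall A : set K, Dset e setT A -> (forall a b, no_interior A a b) ->
    exists k, iter k (@drv K) A `<=` set0.

Section FromDefs.
Variables (L : language) (K : realFieldType) (e : expansion L K).

Lemma definably_complete_lub : definably_complete e -> lub_property e.
Proof.
move=> dc A /definable_Dset/dc[s [us ls]] [x Ax] [b Ab].
have sx : (x%:E <= s)%E by apply: us; exists x.
have sb : (s <= b%:E)%E by apply: ls => _ [y /Ab yb <-]; rewrite lee_fin.
case: s us ls sx sb => [s| |] // us ls _ _; exists s.
  by move=> y Ay; rewrite -lee_fin; apply: us; exists y.
move=> t At; rewrite -lee_fin; apply: ls => _ [y /At yt <-].
by rewrite lee_fin.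
Qed.



Lemma discrete_subset_gap (K' : realFieldType) (D : set K') x :
  discrete_subset D -> D x ->
  exists2 d, 0 < d & forall y, D y -> `|y - x| < d -> y = x.
Proof.
move=> dD /dD[_ [V /nbhs_ballP[d /= d0 dV] VD]].
exists d => // y Dy yx; suff : (V `&` D) y by rewrite VD.
by split=> //; apply: dV; rewrite -ball_normE /= distrC.
Qed.

(** For a set without interior, the open part of its d-minimal decomposition is empty, which leaves
    finitely many discrete sets. *)
Lemma d_minimal_equiv_finite_rank (K' : realFieldType) (e' : expansion L K') :
  d_minimal e -> elementarily_equivalent e e' -> finite_rank e'.
Proof.
move=> [_ dm] /dm{}dm A /definable_Dset/dm.
move=> [U [n [D [oU dD AE]]]] intA; exists n.
suff -> : A = \bigcup_k D k.
  by apply: discrete_union_rank => k x; apply: discrete_subset_gap.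
rewrite AE; apply/seteqP; split=> x; last by right.
case=> // Ux; exfalso.
have /nbhs_ballP[d /= d0 dU] : nbhs x U by apply: open_nbhs_nbhs.
have [|||y [y1 y2 []]] := intA (x - d) (x + d) (x - d) (x + d) => //; first by lra.
rewrite AE; left; apply: dU; rewrite -ball_normE /= ltr_norml; lra.
Qed.

End FromDefs.

(** * Definable compactness and definable choice *)

Section Compactness.
Variables (L : language) (K : realFieldType) (e : expansion L K).
Hypothesis lubK : lub_property e.
Implicit Types (A E X : set K) (Q R : K -> K -> Prop) (a b d : K).

(** Replaces compactness of the interval: the supremum of the [u] with [Q a u] satisfies [Q a] by
    the local hypothesis, and the same hypothesis would push it further if it were below [b]. *)
Lemma interval_induction Q a b : Drel e setT Q -> a <= b ->
  (forall x y z, x <= y -> y <= z -> Q x y -> Q y z -> Q x z) ->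
  (forall t, a <= t -> t <= b -> exists2 d, 0 < d & forall x y,
     t - d < x -> x <= y -> y < t + d -> a <= x -> y <= b -> Q x y) ->
  Q a b.
Proof.
move=> dQ ab Qtrans Qloc.
have Qaa : Q a a.
  have [d d0 h] := Qloc a (lexx a) ab; apply: h => //; lra.
have [|||s us ls] := lubK (A := [set u | a <= u /\ u <= b /\ Q a u]).
- by df.
- by exists a.
- by exists b => x [_ []].
have as' : a <= s by exact: us.
have sb : s <= b by apply: ls => x [_ []].
have [d d0 hd] := Qloc s as' sb.
have [u [[au [ub Qau]] su]] : exists u, (a <= u /\ u <= b /\ Q a u) /\ s - d < u.
  apply: contrapT => h; have : s <= s - d; last by lra.
  apply: ls => x hx; rewrite leNgt; apply/negP => sx; apply: h; by exists x.
have us' : u <= s by exact: us.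
have Qas : Q a s by apply: (Qtrans _ u) => //; apply: hd => //; lra.
move: sb; rewrite le_eqVlt => /orP[/eqP <- //|sb].
suff [w sw [wb Qaw]] : exists2 w, s < w & w <= b /\ Q a w.
  have := us w; rewrite /= => /(_ (conj (le_trans as' (ltW sw)) (conj wb Qaw))).
  by rewrite leNgt sw.
have [bs|bs] := leP b (s + d / 2).
  by exists b => //; split=> //; apply: (Qtrans _ s) => //; [lra|apply: hd => //; lra].
exists (s + d / 2); first by lra.
by split; [lra|apply: (Qtrans _ s) => //; [lra|apply: hd => //; lra]].
Qed.

(** Interval induction on the existence of a common [d]; two adjacent intervals are glued by taking
    the minimum, since [R] persists when [d] shrinks. *)
Lemma uniform_on_interval R a b : Drel e setT R -> a <= b ->
  (forall u d d', 0 < d' -> d' <= d -> R u d -> R u d') ->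
  (forall t, a <= t -> t <= b -> exists2 d, 0 < d &
     forall u, a <= u -> u <= b -> `|u - t| < d -> R u d) ->
  exists2 d, 0 < d & forall u, a <= u -> u <= b -> R u d.
Proof.
move=> dR ab Rmono Rloc.
apply: (interval_induction
  (Q := fun x y => exists2 d, 0 < d & forall u, x <= u -> u <= y -> R u d)) => //.
- apply: (Df_ext (P := fun v => exists d, 0 < d /\
    forall u, v 0%N <= u -> u <= v 1%N -> R u d)) => [v|]; last by df.
  by split=> [[d [? ?]]|[d ? ?]]; exists d.
- move=> x y z xy yz [d d0 h] [d' d'0 h'].
  have m0 : 0 < Num.min d d' by rewrite lt_min d0.
  exists (Num.min d d') => // u xu uz.
  have [uy|yu] := leP u y.
    by apply: (Rmono _ d); rewrite // ?ge_min ?lexx //; apply: h.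
  by apply: (Rmono _ d'); rewrite // ?ge_min ?lexx ?orbT //; apply: h' => //; apply: ltW.
move=> t at' tb; have [d d0 h] := Rloc t at' tb.
exists d => // x y tx xy yt ax yb; exists d => // u xu uy.
by apply: h; rewrite ?ltr_norml; lra.
Qed.

(** Stronger than discreteness of [E] in the interval: limit points outside [E] are excluded too. *)
Definition no_limit E a b := forall t, a <= t -> t <= b ->
  exists2 d, 0 < d & forall x, E x -> `|x - t| < d -> x = t.

Lemma no_limit_separated E a b : Dset e setT E -> a <= b -> no_limit E a b ->
  exists2 d, 0 < d & forall u, a <= u -> u <= b ->
    E u -> forall v, E v -> `|v - u| < d -> v = u.
Proof.
move=> dE ab nE.
apply: (uniform_on_interval
  (R := fun u d => E u -> forall v, E v -> `|v - u| < d -> v = u)) => //.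
- by df.
- by move=> u d d' d'0 d'd h Eu v Ev vu; apply: h => //; lra.
move=> t at' tb; have [d d0 h] := nE t at' tb.
exists (d / 2); first by lra.
move=> u au ub ut Eu v Ev vu.
have -> : u = t by apply: h => //; lra.
apply: h => //; rewrite -(subrKA u); apply: le_lt_trans (ler_normD _ _) _; lra.
Qed.

(** On the interval [E] behaves like a finite set, whatever definable order [R] is used: near each
    point it has at most one element, and the least elements of two adjacent intervals can be
    compared. *)
Lemma no_limit_least E a b R : Dset e setT E -> Drel e setT R -> a <= b ->
  (forall x y z, R x y -> R y z -> R x z) -> (forall x y, x <> y -> R x y \/ R y x) ->
  no_limit E a b -> (exists x, [/\ E x, a <= x & x <= b]) ->
  exists m, [/\ E m, a <= m, m <= b &
    forall z, E z -> a <= z -> z <= b -> z <> m -> R m z].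
Proof.
move=> dE dR ab Rt Rtot nE [x0 [Ex0 ax0 x0b]].
pose Q x y := (forall z, x <= z -> z <= y -> ~ E z) \/
  exists m, E m /\ x <= m /\ m <= y /\
    forall z, E z -> x <= z -> z <= y -> z <> m -> R m z.
suff : Q a b.
  case=> [h|[m [Em [am [mb h]]]]]; last by exists m.
  by case: (h x0).
apply: interval_induction => //; first by rewrite /Q; df.
- move=> x y z xy yz Qxy Qyz; case: Qxy => [h1|[m [Em [xm [my h1]]]]].
    case: Qyz => [h2|[m [Em [ym [mz h2]]]]].
      by left=> u xu uz; have [uy|/ltW yu] := leP u y; [apply: h1|apply: h2].
    right; exists m; split=> //; split; first exact: le_trans ym.
    split=> // u Eu xu uz um; have [uy|/ltW yu] := leP u y; last exact: h2.
    by case: (h1 u).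
  case: Qyz => [h2|[n [En [yn [nz h2]]]]].
    right; exists m; split=> //; split=> //; split; first exact: le_trans yz.
    move=> u Eu xu uz um; have [uy|/ltW yu] := leP u y; first exact: h1.
    by case: (h2 u).
  have [mn|/eqP mn] := eqVneq m n.
    right; exists m; split=> //; split=> //; split; first exact: le_trans yz.
    move=> u Eu xu uz um; have [uy|/ltW yu] := leP u y; first exact: h1.
    by rewrite mn; apply: h2 => //; rewrite -mn.
  have [Rmn|Rnm] := Rtot _ _ mn.
    right; exists m; split=> //; split=> //; split; first exact: le_trans yz.
    move=> u Eu xu uz um; have [uy|/ltW yu] := leP u y; first exact: h1.
    by have [->//|/eqP un] := eqVneq u n; apply: Rt Rmn _; apply: h2.
  right; exists n; split=> //; split; first exact: le_trans yn.
  split=> // u Eu xu uz un; have [uy|/ltW yu] := leP u y; last exact: h2.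
  by have [->//|/eqP um] := eqVneq u m; apply: Rt Rnm _; apply: h1.
move=> t at' tb; have [d d0 h] := nE t at' tb.
exists d => // x y tx xy yt ax yb.
have Et z : E z -> x <= z -> z <= y -> z = t.
  by move=> Ez xz zy; apply: h => //; rewrite ltr_norml; lra.
have [[Et' [xt ty]]|n] := pselect (E t /\ x <= t /\ t <= y).
  by right; exists t; do !split=> //; move=> z Ez xz zy; rewrite (Et z).
by left=> z xz zy Ez; apply: n; rewrite -(Et z).
Qed.

Lemma glb A : Dset e setT A -> (exists x, A x) -> (exists b, forall x, A x -> b <= x) ->
  exists2 s, forall x, A x -> s <= x & forall t, (forall x, A x -> t <= x) -> t <= s.
Proof.
move=> dA [x Ax] [b Ab].
have [|||s us ls] := lubK (A := [set u | A (- u)]).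
- by df.
- by exists (- x) => /=; rewrite opprK.
- by exists (- b) => y /Ab; rewrite lerNr.
exists (- s) => [y Ay|t At]; first by rewrite lerNl; apply: us => /=; rewrite opprK.
by rewrite lerNr; apply: ls => y /At; rewrite lerNr.
Qed.

Lemma closed_least A : Dset e setT A -> closed_set A -> (exists x, A x) ->
  (exists b, forall x, A x -> b <= x) -> exists2 m, A m & forall x, A x -> m <= x.
Proof.
move=> dA cA nA bA; have [s us ls] := glb dA nA bA; exists s => //.
apply: cA => d d0; apply: contrapT => h; have : s + d <= s; last by lra.
apply: ls => x Ax; rewrite leNgt; apply/negP => xs; apply: h; exists x => //.
by have := us _ Ax; rewrite ltr_norml; lra.
Qed.

(** The canonical point is the least nonnegative element of [A] or, when there is none, the greatest
    element. *)
Lemma dcl_closed X A : Dset e X A -> closed_set A -> (exists x, A x) ->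
  exists2 y, A y & dcl e X y.
Proof.
move=> dA cA [x0 Ax0]; have dAT : Dset e setT A by apply: DfS dA.
have cN : closed_set [set x | A (- x)].
  move=> x clx; apply: cA => d /clx[y Ay yx]; exists (- y) => //.
  by rewrite opprK addrC -normrN opprB.
have half B : Dset e setT B -> closed_set B -> closed_set [set x | B x /\ 0 <= x].
  move=> dB cB x clx; split; first by apply: cB => d /clx[y [By _]]; exists y.
  rewrite leNgt; apply/negP => xn; have [|y [_ yp]] := clx (- x); first by lra.
  by rewrite ltr_norml; lra.
have [[x [Ax xp]]|neg] := pselect (exists x, A x /\ 0 <= x).
  have [||||m [Am mp] ml] := closed_least (A := [set x | A x /\ 0 <= x]).
  - by df.
  - exact: half.
  - by exists x.
  - by exists 0 => y [].
  exists m => //; apply: (@dcl_mem _ _ _ _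
    [set x | A x /\ 0 <= x /\ forall y, A y -> 0 <= y -> x <= y]).
  + by df.
  + by split=> //; split=> // y Ay yp; apply: ml.
  by move=> z [Az [zp zl]]; apply: le_anti; rewrite zl //= ml.
have dNT : Dset e setT [set x | A (- x)] by df.
have [||||m [Am mp] ml] := closed_least (A := [set x | A (- x) /\ 0 <= x]).
- by df.
- exact: (half _ dNT cN).
- exists (- x0); rewrite /= opprK; split=> //; rewrite oppr_ge0 leNgt.
  by apply/negP => /ltW x0p; apply: neg; exists x0.
- by exists 0 => y [].
exists (- m) => //; apply: (@dcl_mem _ _ _ _
  [set x | A x /\ forall y, A y -> y <= x]).
- by df.
- split=> // y Ay; rewrite lerNr; apply: ml; rewrite /= opprK; split=> //.
  by rewrite oppr_ge0 leNgt; apply/negP => /ltW yp; apply: neg; exists y.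
move=> z [Az zl]; apply: le_anti; rewrite zl // andbT lerNr; apply: ml.
rewrite /= opprK; split=> //.
by rewrite oppr_ge0 leNgt; apply/negP => /ltW zp; apply: neg; exists z.
Qed.

(** A definable [d] is fixed first: 1 if [F 1] is nonempty, and otherwise half the supremum of the
    [d] for which [F d] is nonempty. A point of the closed set [F d] is then definable over [d]. *)
Lemma dcl_closed_family X (F : K -> set K) : Drel e X F ->
  (forall d, 0 < d -> closed_set (F d)) ->
  (forall d d', 0 < d' -> d' <= d -> F d `<=` F d') ->
  (exists2 d, 0 < d & exists x, F d x) ->
  exists2 y, exists2 d, 0 < d & F d y & dcl e X y.
Proof.
move=> dF cF mF [d0 d00 [x0 Fx0]].
have dS : Dset e X [set d | 0 < d /\ exists x, F d x] by df.
suff [d [dp [x Fx]] dd] : exists2 d, 0 < d /\ (exists x, F d x) & dcl e X d.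
  have [|||y Fy dy] := @dcl_closed (X `|` [set d]) (F d).
  - have dF' : Drel e (X `|` [set d]) F by apply: DfS dF => ?; left.
    by df; apply: DtCst; right.
  - exact: cF.
  - by exists x.
  by exists y; [exists d|apply: Df_dcl1 dd dy].
have [[x Fx]|F1] := pselect (exists x, F 1 x).
  by exists 1; [split=> //; exists x|rewrite /dcl /=; df].
have [|||s us ls] := lubK (A := [set d | 0 < d /\ exists x, F d x]).
- exact: DfS dS.
- by exists d0; split=> //; exists x0.
- exists 1 => d [dp [x Fx]]; rewrite leNgt; apply/negP => d1; apply: F1.
  by exists x; apply: (mF d 1 ltr01 (ltW d1) x Fx).
have sp : 0 < s by apply: lt_le_trans d00 (us d0 (conj d00 (ex_intro _ x0 Fx0))).
exists (s / 2).
  split; first by lra.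
  apply: contrapT => h; have : s <= s / 2; last by lra.
  apply: ls => d [dp [x Fx]]; rewrite leNgt; apply/negP => sd; apply: h.
  by exists x; apply: (mF d (s / 2) _ (ltW sd) x Fx); lra.
apply: (@dcl_mem _ _ _ _ [set z | (forall d, 0 < d /\ (exists x, F d x) -> d <= z * 2) /\
  forall t, (forall d, 0 < d /\ (exists x, F d x) -> d <= t) -> z * 2 <= t]).
- by df.
- by split=> [d /us|t /ls]; rewrite divfK ?pnatr_eq0.
move=> z [uz lz]; have : z * 2 <= s by apply: lz.
by have := ls _ uz; lra.
Qed.

Hypothesis rankK : finite_rank e.

(** Every nonempty definable set contains a closed nonempty piece from a definable family: if [A]
    contains an interval, the centres of balls of radius [d] inside [A], and otherwise the points
    isolated in [A] with gap [d], which exist by finite rank. *)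
Lemma dcl_choice X A : Dset e X A -> (exists x, A x) -> exists2 y, A y & dcl e X y.
Proof.
move=> dA [x0 Ax0].
have [[p [q [pq Apq]]]|nA] := pselect (exists p q, p < q /\ forall x, p < x -> x < q -> A x).
  have [||||y [d d0 Fy] dy] := @dcl_closed_family X
     (fun d x => forall y, `|y - x| < d -> A y).
  - by df.
  - move=> d d0 x clx y yx; have [|z Fz zx] := clx (d - `|y - x|); first by lra.
    by apply: Fz; rewrite -(subrKA x); apply: le_lt_trans (ler_normD _ _) _;
      rewrite (distrC x z); lra.
  - by move=> d d' d'0 d'd x Fx y yx; apply: Fx; lra.
  - exists ((q - p) / 2); first by lra.
    by exists ((p + q) / 2) => y; rewrite ltr_norml => h; apply: Apq; lra.
  by exists y => //; apply: Fy; rewrite subrr normr0.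
have iA a b : no_interior A a b.
  move=> p q _ pq _; apply: contrapT => h; apply: nA; exists p, q; split=> // x px xq.
  by apply: contrapT => nAx; apply: h; exists x.
have [k rk] := rankK (DfS (@subsetT _ X) dA) iA.
have [x [d [Ax d0 hx]]] := rank_isolated (ex_intro _ _ Ax0) rk.
have [||||y [d' d'0 [Ay _]] dy] := @dcl_closed_family X
   (fun d x => A x /\ forall y, A y -> `|y - x| < d -> y = x).
- by df.
- move=> c c0 z clz; have [|y [Ay hy] yz] := clz (c / 2); first by lra.
  have [<- //|/eqP nyz] := eqVneq y z.
  (* A second point [w], closer to [z] than [y] is, would lie within the gap of [y] and so equal
     [y]. *)
  have [|w [Aw hw] wz] := clz (`|y - z|); first by rewrite normr_gt0 subr_eq0; apply/eqP.
  have E : w = y.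
    apply: hy => //; rewrite -(subrKA z); apply: le_lt_trans (ler_normD _ _) _.
    by rewrite (distrC z y); lra.
  by move: wz; rewrite E ltxx.
- by move=> c c' c'0 cc' z [Az hz]; split=> // w Aw wz; apply: hz => //; lra.
- by exists d => //; exists x.
by exists y.
Qed.

(** The part of [A] inside the interval is empty or, having finite rank, has an isolated point; just
    to the right of that point there is a gap. *)
Lemma nowhere_dense A a b : Dset e setT A -> a < b -> no_interior A a b ->
  exists p q, [/\ a <= p, p < q, q <= b & forall x, p < x -> x < q -> ~ A x].
Proof.
move=> dA ab iA.
have [[x0 Bx0]|n] := pselect (exists x, A x /\ a < x /\ x < b); last first.
  by exists a, b; split=> // x ax xb Ax; apply: n; exists x.
have [||k rk] := rankK (A := [set x | A x /\ a < x /\ x < b]).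
- by df.
- move=> c d p q cp pq qd; apply: contrapT => h.
  have B x : p < x -> x < q -> A x /\ a < x /\ x < b.
    by move=> px xq; apply: contrapT => nB; apply: h; exists x.
  (* The middle third has its ends strictly inside, hence in the trace of [A], so they lie between
     [a] and [b]. *)
  have [|||x [px xq nAx]] := iA ((2 * p + q) / 3) ((p + 2 * q) / 3).
  + by have := B ((2 * p + q) / 3); lra.
  + by lra.
  + by have := B ((p + 2 * q) / 3); lra.
  by apply: nAx; have [||//] := B x; lra.
have [x [d [[Ax [ax xb]] d0 hx]]] := rank_isolated (ex_intro _ _ Bx0) rk.
exists x, (Num.min b (x + d)); split; first exact: ltW.
- by rewrite lt_min xb ltrDl.
- by rewrite ge_min lexx.
move=> y xy; rewrite lt_min => /andP[yb yd] Ay.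
have : y = x by apply: hx; [split=> //; lra|rewrite ltr_norml; lra].
by lra.
Qed.

End Compactness.

(** * Types of Cauchy cuts *)

Section CauchyCut.
Variables (L : language) (K : realFieldType) (e : expansion L K).
Hypotheses (lubK : lub_property e) (rankK : finite_rank e).

(** Expresses that [M] is an elementary substructure, while [M] remains a mere subset of [K]. *)
Definition tarski_vaught (M : set K) :=
  forall A : set K, Dset e M A -> (exists x, A x) -> exists2 x, M x & A x.

(** Closeness is measured by the positive elements of [M]; those of [K] may be much smaller. *)
Definition cauchy_cut (M : set K) (c : K) :=
  (forall r, M r -> 0 < r -> exists2 b, M b & `|c - b| < r) /\
  (forall b, M b -> exists r, [/\ M r, 0 < r & r <= `|c - b|]).

Variables (M : set K).
Hypothesis TV : tarski_vaught M.

Lemma tv_dcl y : dcl e M y -> M y.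
Proof. by move=> /TV[|x Mx <- //]; exists y. Qed.

Lemma tv_add x y : M x -> M y -> M (x + y).
Proof. by move=> Mx My; apply: tv_dcl; rewrite /dcl /=; df. Qed.

Lemma tv_opp x : M x -> M (- x).
Proof. by move=> Mx; apply: tv_dcl; rewrite /dcl /=; df. Qed.

Lemma tv_sub x y : M x -> M y -> M (x - y).
Proof. by move=> Mx My; apply: tv_add => //; apply: tv_opp. Qed.

Lemma tv_divn x n : M x -> M (x / n%:R).
Proof. by move=> Mx; apply: tv_dcl; rewrite /dcl /=; df. Qed.

Lemma tv_mul x y : M x -> M y -> M (x * y).
Proof. by move=> Mx My; apply: tv_dcl; rewrite /dcl /=; df. Qed.

Lemma tv_nat n : M n%:R.
Proof. by apply: tv_dcl; rewrite /dcl /=; df. Qed.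

Variable c : K.
Hypothesis cutc : cauchy_cut M c.

Lemma cut_notin : ~ M c.
Proof. by move=> /cutc.2[r [_ r0]]; rewrite subrr normr0 leNgt r0. Qed.

Lemma cut_bounds : exists a b, [/\ M a, M b, a < c & c < b].
Proof.
have [b Mb] := cutc.1 1 (tv_nat 1) ltr01; rewrite ltr_norml => h.
exists (b - 1), (b + 1); split; try lra.
  by apply: tv_sub => //; apply: (tv_nat 1).
by apply: tv_add => //; apply: (tv_nat 1).
Qed.

Lemma cut_shrink a b r : M a -> M b -> a < c -> c < b -> M r -> 0 < r ->
  exists a' b', [/\ M a', M b', a < a', a' < c & [/\ c < b', b' < b & b' - a' < r]].
Proof.
move=> Ma Mb ac cb Mr r0.
have [ra [Mra ra0 ha]] := cutc.2 _ Ma; have [rb [Mrb rb0 hb]] := cutc.2 _ Mb.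
(* With [s] below [r] and below the distances kept from [a] and [b], a point of [M] within [s / 4]
   of [c] gives an interval of length [s / 2] around [c]. *)
have [s [Ms s0 sr sa sb]] : exists s, [/\ M s, 0 < s, s <= r, s <= ra & s <= rb].
  exists (Num.min r (Num.min ra rb)); rewrite !ge_min !lt_min !lexx !orbT /= r0 ra0 rb0.
  by split=> //; do 2?[case: leP => _].
have Ms4 : M (s / 4) by apply: tv_divn.
have s40 : 0 < s / 4 by lra.
have [m Mm] := cutc.1 _ Ms4 s40; rewrite ltr_norml => h.
move: ha hb; rewrite gtr0_norm ?subr_gt0 // ltr0_norm ?subr_lt0 // => ha hb.
by exists (m - s / 4), (m + s / 4); split; [exact: tv_sub|exact: tv_add| | |split]; lra.
Qed.

(** By induction the derivative of [E] stays away from [c], so near [c] the points of [E] are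
    separated by some [r], which can be taken in [M]. An interval around [c] shorter than [r]
    contains at most one point of [E]; it is definable over [M], hence differs from [c], and cutting
    there leaves an interval free of [E]. *)
Lemma cut_avoids_rank k E : Dset e M E -> closed_set E -> iter k (@drv K) E `<=` set0 ->
  exists a b, [/\ M a, M b, a < c, c < b & forall x, a < x -> x < b -> ~ E x].
Proof.
elim: k E => [|k IH] E dE cE rk.
  by have [a [b [Ma Mb ac cb]]] := cut_bounds; exists a, b; split=> // x _ _ /rk.
have dE' : Dset e M (drv E).
  apply: (Df_ext (P := fun v => E (v 0%N) /\ forall d, 0 < d ->
    exists y, E y /\ y <> v 0%N /\ `|y - v 0%N| < d)) => [v|]; last by df.
  split=> -[Ev h]; split=> // d /h[y]; first by move=> [? []]; exists y.
  by move=> [? ? ?]; exists y.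
have [a0 [b0 [Ma0 Mb0 a0c cb0 h0]]] : exists a b, [/\ M a, M b, a < c, c < b &
    forall x, a < x -> x < b -> ~ drv E x].
  by apply: IH => //; [exact: drv_closed|rewrite -iterSr].
have [a [b [Ma Mb a0a ac [cb bb0 _]]]] :=
  cut_shrink Ma0 Mb0 a0c cb0 (tv_nat 1) ltr01.
have nE : no_limit E a b.
  move=> t at' tb; apply: contrapT => h; apply: (h0 t); try lra.
  have hd d : 0 < d -> exists y, [/\ E y, y <> t & `|y - t| < d].
    move=> d0; apply: contrapT => h'; apply: h; exists d => // y Ey yt.
    by apply: contrapT => nyt; apply: h'; exists y.
  by split=> //; apply: cE => d /hd[y [? _ ?]]; exists y.
have [r [Mr r0 hr]] : exists r, [/\ M r, 0 < r & forall u, a <= u -> u <= b -> E u ->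
    forall v, E v -> `|v - u| < r -> v = u].
  have [||r Mr [r0 hr]] := @TV [set r | 0 < r /\ forall u, a <= u -> u <= b -> E u ->
      forall v, E v -> `|v - u| < r -> v = u].
  - by df.
  - have [|r r0 hr] := no_limit_separated lubK (DfS (@subsetT _ M) dE) _ nE; first lra.
    by exists r.
  by exists r.
have [a' [b' [Ma' Mb' aa' a'c [cb' b'b ab']]]] := cut_shrink Ma Mb ac cb Mr r0.
have [[x [Ex [a'x xb']]]|n] := pselect (exists x, E x /\ a' < x /\ x < b'); last first.
  by exists a', b'; split=> // x a'x xb' Ex; apply: n; exists x.
have xu z : E z -> a' < z -> z < b' -> z = x.
  by move=> Ez a'z zb'; apply: hr => //; rewrite ?ltr_norml; lra.
have Mx : M x.
  apply: tv_dcl; apply: (@dcl_mem _ _ _ _ [set x | E x /\ a' < x /\ x < b']) => //.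
    by df.
  by move=> z [? [? ?]]; apply: xu.
have [xc|cx|xc] := ltgtP x c; last by case: cut_notin; rewrite -xc.
  by exists x, b'; split=> // z xz zb' Ez; move: (xu z Ez); lra.
by exists a', x; split=> // z a'z zx Ez; move: (xu z Ez); lra.
Qed.

(** In any interval either [A] has no interior, and a smaller interval misses [A] and so leaves
    [cl A], or [A] contains an interval, which leaves the closure of the complement. *)
Lemma boundary_no_interior A a b : Dset e setT A ->
  no_interior (cl A `&` cl (~` A)) a b.
Proof.
move=> dA p q ap pq qb; apply: contrapT => h.
have B x : p < x -> x < q -> cl A x /\ cl (~` A) x.
  by move=> px xq; apply: contrapT => nB; apply: h; exists x.
have [iA|niA] := pselect (no_interior A p q).
  have [p' [q' [pp' p'q' q'q nA]]] := nowhere_dense rankK dA pq iA.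
  have [||+ _] := B ((p' + q') / 2); [lra|lra|].
  move=> /(_ ((q' - p') / 2))[|y Ay]; first lra.
  by rewrite ltr_norml => hy; apply: (nA y) => //; lra.
apply: niA => p' q' pp' p'q' q'q; apply: contrapT => h'.
have [||_] := B ((p' + q') / 2); [lra|lra|].
move=> /(_ ((q' - p') / 2))[|y nAy]; first lra.
by rewrite ltr_norml => hy; apply: h'; exists y; split=> //; lra.
Qed.

(** Definable connectedness of intervals, by interval induction. *)
Lemma locally_constant A a b : Dset e setT A -> a <= b ->
  (forall x, a <= x -> x <= b -> ~ (cl A x /\ cl (~` A) x)) ->
  (forall x, a <= x -> x <= b -> A x) \/ (forall x, a <= x -> x <= b -> ~ A x).
Proof.
move=> dA ab bA.
apply: (interval_induction lubK (Q := fun p q =>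
  (forall x, p <= x -> x <= q -> A x) \/ (forall x, p <= x -> x <= q -> ~ A x))) => //.
- by df.
- move=> x y z xy yz [h1|h1] [h2|h2].
  + left=> u xu uz; have [uy|/ltW yu] := leP u y; [exact: h1|exact: h2].
  + by case: (h2 y) => //; apply: h1.
  + by case: (h1 y) => //; apply: h2.
  + right=> u xu uz; have [uy|/ltW yu] := leP u y; [exact: h1|exact: h2].
move=> t at' tb; have [ncA|ncA] : ~ cl A t \/ ~ cl (~` A) t.
- by apply/not_andP; apply: bA.
- have [d d0 hd] : exists2 d, 0 < d & forall y, `|y - t| < d -> ~ A y.
    apply: contrapT => h; apply: ncA => d d0; apply: contrapT => h'; apply: h.
    by exists d => // y yt Ay; apply: h'; exists y.
  exists d => // x y tx xy yt ax yb; right=> z xz zy; apply: hd.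
  by rewrite ltr_norml; lra.
- have [d d0 hd] : exists2 d, 0 < d & forall y, `|y - t| < d -> A y.
    apply: contrapT => h; apply: ncA => d d0; apply: contrapT => h'; apply: h.
    by exists d => // y yt; apply: contrapT => nAy; apply: h'; exists y.
  exists d => // x y tx xy yt ax yb; left=> z xz zy; apply: hd.
  by rewrite ltr_norml; lra.
Qed.

(* The type of c over M is determined by its cut: the boundary of A is closed
   of finite rank, so its part near c consists of isolated points, which lie
   in M. *)
Lemma cut_decides A : Dset e M A -> exists a b, [/\ M a, M b, a < c, c < b &
  (forall x, a < x -> x < b -> A x) \/ (forall x, a < x -> x < b -> ~ A x)].
Proof.
move=> dA; have dAT : Dset e setT A by apply: DfS dA.
have dE : Dset e M (cl A `&` cl (~` A)).
  apply: (Df_ext (P := fun v =>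
    (forall d, 0 < d -> exists y, A y /\ `|y - v 0%N| < d) /\
    (forall d, 0 < d -> exists y, ~ A y /\ `|y - v 0%N| < d))) => [v|]; last by df.
  by split=> -[h1 h2]; split=> d d0; have := h1 d d0; have := h2 d d0;
     move=> [y ? ?] [z ? ?] || move=> [y [? ?]] [z [? ?]]; (exists y + exists z).
have [k rk] := rankK (DfS (@subsetT _ M) dE) (fun a b => boundary_no_interior dAT).
have cE : closed_set (cl A `&` cl (~` A)).
  by move=> x clx; split; apply: cl_closed => d /clx[y []]; exists y.
have [a [b [Ma Mb ac cb h]]] := cut_avoids_rank dE cE rk.
have [a' [b' [Ma' Mb' aa' a'c [cb' b'b _]]]] :=
  cut_shrink Ma Mb ac cb (tv_nat 1) ltr01.
exists a', b'; split=> //.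
have [|x a'x xb'|H|H] := locally_constant (a := a') (b := b') dAT; first lra.
- by apply: h; lra.
- by left=> x /ltW a'x /ltW xb'; apply: H.
- by right=> x /ltW a'x /ltW xb'; apply: H.
Qed.

Lemma cut_interval A : Dset e M A -> A c -> exists a b, [/\ M a, M b, a < c, c < b &
  forall x, a < x -> x < b -> A x].
Proof.
move=> /cut_decides[a [b [Ma Mb ac cb [h|h]]]] Ac; first by exists a, b.
by case: (h c).
Qed.

End CauchyCut.

(** * Ultrapowers *)

Section Ultrapower.
Variables (I : Type) (U : set_system I) (UU : UltraFilter U) (K : realFieldType).
Implicit Types (f g h : I -> K) (P Q : I -> Prop).

Definition ae P : Prop := U [set i | P i].

Lemma aeW P : (forall i, P i) -> ae P.
Proof. by move=> hP; apply: filterS filterT => i _; apply: hP. Qed.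

Lemma ae_imp P Q : (forall i, P i -> Q i) -> ae P -> ae Q.
Proof. by move=> PQ; apply: filterS. Qed.

Lemma ae_and P Q : ae (fun i => P i /\ Q i) <-> ae P /\ ae Q.
Proof.
split=> [h|[hP hQ]]; last exact: filterI.
by split; apply: ae_imp h => i [].
Qed.

Lemma ae_exists P : ae P -> exists i, P i.
Proof. by move=> /filter_ex[i]; exists i. Qed.

Lemma ae_not P : ae (fun i => ~ P i) <-> ~ ae P.
Proof.
split=> [h1 h2|h].
  by have [|i []] := @ae_exists (fun i => ~ P i /\ P i); first exact/ae_and.
by case: (in_ultra_setVsetC [set i | P i] UU).
Qed.

Definition ueq f g : bool := `[< ae (fun i => f i = g i) >].

Lemma ueq_refl : reflexive ueq.
Proof. by move=> f; apply/asboolP/aeW. Qed.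

Lemma ueq_sym : symmetric ueq.
Proof.
by move=> f g; apply/asboolP/asboolP; apply: ae_imp => i ->.
Qed.

Lemma ueq_trans : transitive ueq.
Proof.
move=> g f h /asboolP fg /asboolP gh; apply/asboolP.
by apply: ae_imp (proj2 (ae_and _ _) (conj fg gh)) => i [-> ->].
Qed.

Canonical ueq_equiv := EquivRel ueq ueq_refl ueq_sym ueq_trans.

Definition upower := {eq_quot ueq}%qT.
HB.instance Definition _ : EqQuotient _ ueq upower := EqQuotient.on upower.
HB.instance Definition _ := Choice.on upower.

Definition cls f : upower := (\pi_upower f)%qT.
Definition rep (x : upower) : I -> K := repr x.

Lemma cls_rep x : cls (rep x) = x. Proof. exact: reprK. Qed.

Lemma cls_eq f g : cls f = cls g <-> ae (fun i => f i = g i).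
Proof.
split=> [/eqP|h]; last by apply/eqP; rewrite eqmodE; apply/asboolP.
by rewrite eqmodE => /asboolP.
Qed.

Lemma rep_cls f : ae (fun i => rep (cls f) i = f i).
Proof. by apply/cls_eq; rewrite cls_rep. Qed.

Lemma upowerW (P : upower -> Prop) : (forall f, P (cls f)) -> forall x, P x.
Proof. by move=> h x; rewrite -(cls_rep x). Qed.

(** Operations act on chosen representatives; lemmas such as [uaddE] show that any other
    representatives give the same class. *)
Definition uadd (x y : upower) := cls (fun i => rep x i + rep y i).
Definition umul (x y : upower) := cls (fun i => rep x i * rep y i).
Definition uopp (x : upower) := cls (fun i => - rep x i).
Definition uinv (x : upower) := cls (fun i => (rep x i)^-1).
Definition ule (x y : upower) := `[< ae (fun i => rep x i <= rep y i) >].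
Definition ult (x y : upower) := (y != x) && ule x y.
Definition unorm (x : upower) := cls (fun i => `|rep x i|).

Lemma uaddE f g : uadd (cls f) (cls g) = cls (fun i => f i + g i).
Proof.
apply/cls_eq; apply: ae_imp (proj2 (ae_and _ _) (conj (rep_cls f) (rep_cls g))).
by move=> i [-> ->].
Qed.

Lemma umulE f g : umul (cls f) (cls g) = cls (fun i => f i * g i).
Proof.
apply/cls_eq; apply: ae_imp (proj2 (ae_and _ _) (conj (rep_cls f) (rep_cls g))).
by move=> i [-> ->].
Qed.

Lemma uoppE f : uopp (cls f) = cls (fun i => - f i).
Proof. by apply/cls_eq; apply: ae_imp (rep_cls f) => i ->. Qed.

Lemma uinvE f : uinv (cls f) = cls (fun i => (f i)^-1).
Proof. by apply/cls_eq; apply: ae_imp (rep_cls f) => i ->. Qed.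

Lemma unormE f : unorm (cls f) = cls (fun i => `|f i|).
Proof. by apply/cls_eq; apply: ae_imp (rep_cls f) => i ->. Qed.

Lemma uleP f g : reflect (ae (fun i => f i <= g i)) (ule (cls f) (cls g)).
Proof.
apply: (iffP (asboolP _)) => h;
  apply: ae_imp (proj2 (ae_and _ _) (conj h
    (proj2 (ae_and _ _) (conj (rep_cls f) (rep_cls g))))).
  by move=> i [le_fg [<- <-]].
by move=> i [le_fg [-> ->]].
Qed.

Fact uaddA : associative uadd.
Proof.
elim/upowerW=> f; elim/upowerW=> g; elim/upowerW=> h.
by rewrite !uaddE; congr cls; apply/funext => i; rewrite addrA.
Qed.

Fact uaddC : commutative uadd.
Proof.
elim/upowerW=> f; elim/upowerW=> g.
by rewrite !uaddE; congr cls; apply/funext => i; rewrite addrC.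
Qed.

Fact uadd0 : left_id (cls (fun=> 0)) uadd.
Proof.
by elim/upowerW=> f; rewrite uaddE; congr cls; apply/funext => i; rewrite add0r.
Qed.

Fact uaddN : left_inverse (cls (fun=> 0)) uopp uadd.
Proof.
elim/upowerW=> f; rewrite uoppE uaddE; congr cls.
by apply/funext => i; rewrite addNr.
Qed.

HB.instance Definition _ := GRing.isZmodule.Build upower uaddA uaddC uadd0 uaddN.

Fact umulA : associative umul.
Proof.
elim/upowerW=> f; elim/upowerW=> g; elim/upowerW=> h.
by rewrite !umulE; congr cls; apply/funext => i; rewrite mulrA.
Qed.

Fact umulC : commutative umul.
Proof.
elim/upowerW=> f; elim/upowerW=> g.
by rewrite !umulE; congr cls; apply/funext => i; rewrite mulrC.
Qed.

Fact umul1 : left_id (cls (fun=> 1)) umul.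
Proof.
by elim/upowerW=> f; rewrite umulE; congr cls; apply/funext => i; rewrite mul1r.
Qed.

Fact umulD : left_distributive umul uadd.
Proof.
elim/upowerW=> f; elim/upowerW=> g; elim/upowerW=> h.
by rewrite !(umulE, uaddE); congr cls; apply/funext => i; rewrite mulrDl.
Qed.

Fact uoner_neq0 : cls (fun=> 1) != cls (fun=> 0).
Proof.
apply/eqP => /cls_eq/ae_exists[i] /eqP.
by rewrite oner_eq0.
Qed.

HB.instance Definition _ :=
  GRing.Zmodule_isComNzRing.Build upower umulA umulC umul1 umulD uoner_neq0.

Fact umulV (x : upower) : x != 0 -> uinv x * x = 1.
Proof.
elim/upowerW: x => f f0; rewrite uinvE -[LHS]/(umul _ _) umulE; apply/cls_eq.
have : ae (fun i => ~ (f i = 0)) by apply/ae_not => /cls_eq h; rewrite h eqxx in f0.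
by apply: ae_imp => i /eqP h; rewrite mulVf.
Qed.

Fact uinv0 : uinv 0 = 0.
Proof. by rewrite -[LHS]/(uinv (cls _)) uinvE invr0. Qed.

HB.instance Definition _ := GRing.ComNzRing_isField.Build upower umulV uinv0.

Fact ule0_add (x y : upower) : ule 0 x -> ule 0 y -> ule 0 (x + y).
Proof.
elim/upowerW: x => f; elim/upowerW: y => g /uleP hf /uleP hg.
rewrite -[_ + _]/(uadd _ _) uaddE; apply/uleP.
by apply: ae_imp (proj2 (ae_and _ _) (conj hf hg)) => i [? ?]; rewrite addr_ge0.
Qed.

Fact ule0_mul (x y : upower) : ule 0 x -> ule 0 y -> ule 0 (x * y).
Proof.
elim/upowerW: x => f; elim/upowerW: y => g /uleP hf /uleP hg.
rewrite -[_ * _]/(umul _ _) umulE; apply/uleP.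
by apply: ae_imp (proj2 (ae_and _ _) (conj hf hg)) => i [? ?]; rewrite mulr_ge0.
Qed.

Fact ule0_anti (x : upower) : ule 0 x -> ule x 0 -> x = 0.
Proof.
elim/upowerW: x => f /uleP h1 /uleP h2; apply/cls_eq.
apply: ae_imp (proj2 (ae_and _ _) (conj h1 h2)) => i [? ?].
by apply: le_anti; apply/andP.
Qed.

Fact usub_ge0 (x y : upower) : ule 0 (y - x) = ule x y.
Proof.
elim/upowerW: x => f; elim/upowerW: y => g.
rewrite -[_ - _]/(uadd _ (uopp _)) uoppE uaddE.
by apply/uleP/uleP; apply: ae_imp => i; rewrite subr_ge0.
Qed.

Fact ule0_total (x : upower) : ule 0 x || ule x 0.
Proof.
elim/upowerW: x => f; apply/orP.
have [h|h] := pselect (ae (fun i => 0 <= f i)); first by left; apply/uleP.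
right; apply/uleP; move/ae_not: h; apply: ae_imp => i /negP.
by rewrite -ltNge => /ltW.
Qed.

Fact unormN (x : upower) : unorm (- x) = unorm x.
Proof.
elim/upowerW: x => f; rewrite -[- _]/(uopp _) uoppE !unormE; congr cls.
by apply/funext => i; rewrite normrN.
Qed.

Fact uge0_norm (x : upower) : ule 0 x -> unorm x = x.
Proof.
elim/upowerW: x => f /uleP h; rewrite unormE; apply/cls_eq.
by apply: ae_imp h => i /ger0_norm.
Qed.

Fact ult_def (x y : upower) : ult x y = (y != x) && ule x y.
Proof. by []. Qed.

HB.instance Definition _ := Num.IntegralDomain_isLeReal.Build upower
  ule0_add ule0_mul ule0_anti usub_ge0 ule0_total unormN uge0_norm ult_def.

Definition ultrapower : realFieldType := upower.

End Ultrapower.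

(** * Transfer of completeness along elementary equivalence *)

Section SentenceTransfer.
Variable L : language.

(** Elementary equivalence speaks of sentences only, so parameters are replaced by an existential
    closure. *)
Fixpoint fclose n : formula L n -> formula L 0 :=
  match n with
  | 0%N => id
  | n'.+1 => fun phi => fclose (FEx phi)
  end.

Lemma sat_fclose (K : realFieldType) (e : expansion L K) n (phi : formula L n) v :
  sat e v (fclose phi) <-> exists w, sat e w phi.
Proof.
elim: n phi => [|n IH] phi /=.
  split=> [h|[w h]]; first by exists v.
  by have -> : v = w by apply/funext => -[].
rewrite IH /=; split=> [[w [x h]]|[w h]]; first by exists (env_cons x w).
exists (w \o lift ord0), (w ord0).
suff -> : env_cons (w ord0) (w \o lift ord0) = w by [].
apply/funext => i; case: (unliftP ord0 i) => [j|] ->.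
  by rewrite env_consS.
by rewrite env_cons0.
Qed.

Definition pvar (p : pform L void) (i : 'I_(psize p)) : nat :=
  if passign i is inl k then k else 0%N.

(** Only the indices up to the largest one used matter, which makes the closure of an infinite
    environment finite. *)
Definition pclose (p : pform L void) : formula L 0 :=
  fclose (frename (pbody p) (fun i => inord (pvar i) : 'I_(\max_(i < psize p) pvar i).+1)).

Lemma sat_pclose (K : realFieldType) (e : expansion L K) p v :
  sat e v (pclose p) <-> exists w, psat e (of_void K) p w.
Proof.
rewrite sat_fclose; split=> -[w].
  rewrite sat_rename => h; exists (w \o inord); rewrite /psat.
  suff <- : (w \o fun i => inord (pvar i)) = (look (of_void K) (w \o inord) \o @passign _ _ p) by [].
  by apply/funext => i; rewrite /pvar /=; case: passign => // -[].
move=> h; exists (fun i => w (val i)); rewrite sat_rename.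
suff -> : (fun i => w (val i)) \o (fun i => inord (pvar i) : 'I_(\max_(i < psize p) pvar i).+1)
  = look (of_void K) w \o @passign _ _ p by [].
apply/funext => i /=; rewrite inordK ?ltnS ?leq_bigmax //.
by rewrite /pvar; case: passign => // -[].
Qed.

(** Variable 0 is the candidate upper bound. Under the quantifier it becomes variable 1, which the
    substitution skips. *)
Definition pub (p : pform L void) :=
  pnot (pex (pand (psubst (fun k => inl (if k is 0%N then 0%N else k.+1)) p)
                  (plt L (inl 1%N) (inl 0%N)))).

Lemma psat_pub (K : realFieldType) (e : expansion L K) j p s w :
  psat e j (pub p) (scons s w) <-> forall x, psat e j p (scons x w) -> x <= s.
Proof.
rewrite psat_not psat_ex.
have E x : (look j (scons x (scons s w)) \o
  (fun k => inl (if k is 0%N then 0%N else k.+1))) = scons x w.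
  by apply/funext => -[].
split=> [h x px|h [x]].
  rewrite leNgt; apply/negP => sx; apply: h; exists x.
  by rewrite psat_and psat_subst E psat_lt.
by rewrite psat_and psat_subst E psat_lt /= => -[/h]; rewrite leNgt => /negP.
Qed.

Definition pnolub (p : pform L void) :=
  pand (pex p) (pand (pex (pub p)) (pnot (pex (pand (pub p)
    (pnot (pex (pand (psubst (fun k => inl (if k is 0%N then 0%N else k.+1)) (pub p))
                     (plt L (inl 0%N) (inl 1%N))))))))).

Lemma psat_nolub (K : realFieldType) (e : expansion L K) j p w :
  psat e j (pnolub p) w <->
  [/\ exists x, psat e j p (scons x w),
      exists b, forall x, psat e j p (scons x w) -> x <= b &
      ~ exists2 s, forall x, psat e j p (scons x w) -> x <= s &
          forall t, (forall x, psat e j p (scons x w) -> x <= t) -> s <= t].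
Proof.
have E t s : (look j (scons t (scons s w)) \o
  (fun k => inl (if k is 0%N then 0%N else k.+1))) = scons t w.
  by apply/funext => -[].
rewrite !psat_and psat_not !psat_ex.
split=> [[h1 [[b /psat_pub h2] h3]]|[h1 [b h2] h3]].
  split=> //; first by exists b.
  move=> [s us ls]; apply: h3; exists s; rewrite psat_and; split; first exact/psat_pub.
  rewrite psat_not psat_ex => -[t]; rewrite psat_and psat_subst E psat_lt /=.
  by move=> [/psat_pub/ls]; rewrite leNgt => /negP.
split=> //; split; first by exists b; apply/psat_pub.
move=> [s]; rewrite psat_and psat_not psat_ex => -[/psat_pub us ls].
apply: h3; exists s => // t ut; rewrite leNgt; apply/negP => ts; apply: ls.
by exists t; rewrite psat_and psat_subst E psat_lt; split=> //; apply/psat_pub.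
Qed.

(** A counterexample in [K'] makes the sentence [pclose (pnolub p)] true there, hence in [K], where
    the parameters witnessing it define a counterexample. *)
Lemma equiv_lub_property (K K' : realFieldType) (e : expansion L K)
    (e' : expansion L K') :
  elementarily_equivalent e e' -> lub_property e -> lub_property e'.
Proof.
move=> ee' lub A /definable_Dset[n [phi [v AE]]] nA bA; apply: contrapT => nlub.
pose p : pform L void := PForm phi (fun i => inl (val i)).
(* The finite list of parameters, padded with 0. *)
pose w k := oapp v 0 (insub k : option 'I_n).
have Aw x : A x <-> psat e' (of_void K') p (scons x w).
  rewrite AE /psat /=; suff -> : env_cons x v = look (of_void K') (scons x w) \o
    (fun i => inl (val i)) by [].
  apply/funext => i /=; case: (unliftP ord0 i) => [j|] ->; last by rewrite env_cons0.
  by rewrite env_consS /= /w valK.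
have H : sat e' (fun=> 0) (pclose (pnolub p)).
  apply/sat_pclose; exists w; apply/psat_nolub; split.
  - by have [x /Aw] := nA; exists x.
  - by have [b hb] := bA; exists b => x /Aw/hb.
  - move=> [s us ls]; apply: nlub; exists s => [x /Aw/us //|t ut].
    by apply: ls => x /Aw/ut.
have /sat_pclose[u /psat_nolub[n1 b1]] := (ee' _ (fun=> 0) (fun=> 0)).2 H.
apply; apply: lub => //.
exists (PForm phi (fun i => if val i is k.+1 then inr (u k) else inl 0%N)) => //.
move=> x; rewrite /psat /=; suff -> : look (of_void K) (scons (x 0%N) u) \o
  (fun i : 'I_n.+1 => inl (val i)) = look id x \o (fun i : 'I_n.+1 =>
  if val i is k.+1 then inr (u k) else inl 0%N) by [].
by apply/funext => i /=; case: (nat_of_ord i).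
Qed.

Lemma d_minimal_equiv (K K' : realFieldType) (e : expansion L K)
    (e' : expansion L K') :
  d_minimal e -> elementarily_equivalent e e' -> lub_property e' /\ finite_rank e'.
Proof.
move=> dm ee'; split.
  by apply: equiv_lub_property ee' _; apply: definably_complete_lub dm.1.
exact: d_minimal_equiv_finite_rank dm ee'.
Qed.

Lemma elementarily_equivalent_refl (K : realFieldType) (e : expansion L K) :
  elementarily_equivalent e e.
Proof.
move=> phi v v'; suff -> : v = v' by [].
by apply/funext => -[].
Qed.

Lemma elementarily_equivalent_trans (K1 K2 K3 : realFieldType)
    (e1 : expansion L K1) (e2 : expansion L K2) (e3 : expansion L K3) :
  elementarily_equivalent e1 e2 -> elementarily_equivalent e2 e3 ->
  elementarily_equivalent e1 e3.
Proof.
by move=> h12 h23 phi v v'; rewrite (h12 phi v (fun=> 0)).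
Qed.

Lemma elementary_embedding_equiv (K K' : realFieldType) (e : expansion L K)
    (e' : expansion L K') (i : K -> K') :
  elementary_embedding e e' i -> elementarily_equivalent e e'.
Proof.
move=> ei phi v v'; rewrite ei; suff -> : i \o v = v' by [].
by apply/funext => -[].
Qed.

End SentenceTransfer.

(** * The theorem of Los and the diagonal embedding *)

Section Los.
Variables (L : language) (I : Type) (U : set_system I) (UU : UltraFilter U).
Variables (K : realFieldType) (e : expansion L K).
Local Notation N := (ultrapower UU K).

Definition upower_expansion : expansion L N :=
  Expansion (fun f (v : 'I_(farity f) -> N) =>
               cls UU (fun i => finterp e (fun k => rep (v k) i)))
            (fun r (v : 'I_(rarity r) -> N) =>
               ae U (fun i => rinterp e (fun k => rep (v k) i))).
Local Notation eN := upower_expansion.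

Lemma ae_forall n (P : 'I_n -> I -> Prop) :
  (forall k, ae U (P k)) -> ae U (fun i => forall k, P k i).
Proof. by move=> h; apply: (@filter_forall I 'I_n P U _). Qed.

Lemma eval_upower n (v : 'I_n -> N) t :
  ae U (fun i => rep (eval eN v t) i = eval e (fun k => rep (v k) i) t).
Proof.
elim: t => [k| | |t1 IH1 t2 IH2|t1 IH1 t2 IH2|f ts IH] /=.
- exact: aeW.
- exact: (rep_cls UU).
- exact: (rep_cls UU).
- have := rep_cls UU (fun i => rep (eval eN v t1) i + rep (eval eN v t2) i).
  move=> /(conj (conj IH1 IH2)) [h1 h2]; apply: ae_imp (proj2 (ae_and _ _ _)
    (conj h2 (proj2 (ae_and _ _ _) h1))) => i [E [<- <-]].
  exact: E.
- have := rep_cls UU (fun i => rep (eval eN v t1) i * rep (eval eN v t2) i).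
  move=> /(conj (conj IH1 IH2)) [h1 h2]; apply: ae_imp (proj2 (ae_and _ _ _)
    (conj h2 (proj2 (ae_and _ _ _) h1))) => i [E [<- <-]].
  exact: E.
have := rep_cls UU (fun i => finterp e (fun k => rep (eval eN v (ts k)) i)).
move=> /(conj (ae_forall IH))/(proj2 (ae_and _ _ _)).
apply: ae_imp => i [h ->]; congr finterp; exact/funext.
Qed.

Lemma rep_eq (x y : N) : x = y <-> ae U (fun i => rep x i = rep y i).
Proof. by rewrite -[x in x = y]cls_rep -[y in _ = y]cls_rep cls_eq. Qed.

Lemma rep_le (x y : N) : x <= y <-> ae U (fun i => rep x i <= rep y i).
Proof. by split=> [/asboolP //|h]; apply/asboolP. Qed.

Lemma rep_lt (x y : N) : x < y <-> ae U (fun i => rep x i < rep y i).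
Proof.
have -> : (x < y) = ~~ (y <= x) by rewrite -ltNge.
split=> [/negP h|h].
  have /(ae_not UU) : ~ ae U (fun i => rep y i <= rep x i) by move=> /rep_le.
  by apply: ae_imp => i /negP; rewrite -ltNge.
apply/negP => /rep_le h'.
by have [i [+ +]] := ae_exists UU (proj2 (ae_and _ _ _) (conj h h')); rewrite leNgt => ->.
Qed.

Lemma cls_lt (f g : I -> K) :
  ((cls UU f : N) < cls UU g) <-> ae U (fun i => f i < g i).
Proof.
rewrite rep_lt; have h := proj2 (ae_and UU _ _) (conj (rep_cls UU f) (rep_cls UU g)).
split=> h'; apply: ae_imp (proj2 (ae_and UU _ _) (conj h h')) => i [[E1 E2]].
  by rewrite E1 E2.
by rewrite E1 E2.
Qed.

Lemma cls_dist (f g : I -> K) :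
  `|(cls UU f : N) - cls UU g| = cls UU (fun i => `|f i - g i|).
Proof.
by rewrite -[LHS]/(unorm (uadd _ (uopp _))) uoppE uaddE unormE.
Qed.

(** By induction on the formula. For a quantifier, witnesses are chosen at each index, with default
    0 where there is none, and their class is the witness in the ultrapower. *)
Lemma los n (phi : formula L n) (v : 'I_n -> N) :
  sat eN v phi <-> ae U (fun i => sat e (fun k => rep (v k) i) phi).
Proof.
elim: n / phi v => [n t1 t2|n t1 t2|n r ts|n phi IH|n phi1 IH1 phi2 IH2|n phi IH] v /=.
- rewrite rep_eq; split=> h;
  apply: ae_imp (proj2 (ae_and _ _ _) (conj h (proj2 (ae_and _ _ _)
     (conj (eval_upower v t1) (eval_upower v t2))))) => i [h' [E1 E2]].
    by rewrite -E1 -E2.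
  by rewrite E1 E2.
- rewrite rep_lt; split=> h;
  apply: ae_imp (proj2 (ae_and _ _ _) (conj h (proj2 (ae_and _ _ _)
     (conj (eval_upower v t1) (eval_upower v t2))))) => i [h' [E1 E2]].
    by rewrite -E1 -E2.
  by rewrite E1 E2.
- have hts := ae_forall (fun k => eval_upower v (ts k)).
  split=> h; apply: ae_imp (proj2 (ae_and _ _ _) (conj h hts)) => i [h' E].
    by under eq_fun do rewrite -E.
  by under eq_fun do rewrite E.
- by rewrite ae_not IH.
- by rewrite ae_and IH1 IH2.
have cons_rep (x : N) i : (fun k => rep (env_cons x v k) i) =
    env_cons (rep x i) (fun k => rep (v k) i).
  apply/funext => k; case: (unliftP ord0 k) => [j|] ->.
    by rewrite !env_consS.
  by rewrite !env_cons0.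
split=> [[x /IH]|h].
  by apply: ae_imp => i h; exists (rep x i); rewrite -cons_rep.
have /boolp.choice[g hg] : forall i, exists y,
    (exists x, sat e (env_cons x (fun k => rep (v k) i)) phi) ->
    sat e (env_cons y (fun k => rep (v k) i)) phi.
  move=> i.
  have [[x hx]|n0] := pselect (exists x, sat e (env_cons x (fun k => rep (v k) i)) phi).
    by exists x.
  by exists 0.
exists (cls UU g); apply/IH.
apply: ae_imp (proj2 (ae_and _ _ _) (conj h (rep_cls UU g))) => i [/hg hi E].
by rewrite cons_rep E.
Qed.

Definition diag (a : K) : N := cls UU (fun=> a).

Lemma diag_elementary : elementary_embedding e eN diag.
Proof.
move=> n phi v; rewrite los.
have E : ae U (fun i => forall k, rep ((diag \o v) k) i = v k).
  by apply: ae_forall => k; apply: rep_cls.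
split=> h.
  by apply: ae_imp E => i /funext ->.
by have [i [hi /funext Ei]] := ae_exists UU (proj2 (ae_and _ _ _) (conj h E)); rewrite -Ei.
Qed.

End Los.

(** * Definable Baire category *)

Section UniformRank.
Variables (L : language) (K : realFieldType) (e : expansion L K).
Hypothesis rank_equiv : forall (K' : realFieldType) (e' : expansion L K'),
  elementarily_equivalent e e' -> finite_rank e'.

Section Internal.
Variables (U : set_system nat) (UU : UltraFilter U).
Local Notation N := (ultrapower UU K).

(** The ultraproduct of a sequence of sets. *)
Definition internal (A : nat -> set K) : set N :=
  [set x | ae U (fun i => A i (rep x i))].

Lemma internal_drv A : internal (fun i => drv (A i)) `<=` drv (internal A).
Proof.
move=> x hx; split; first by apply: ae_imp hx => i [].
move=> d /rep_lt d0.
(* The representative of 0 vanishes only almost everywhere, hence the third premise. *)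
have /boolp.choice[g hg] : forall i, exists y, drv (A i) (rep x i) -> rep (0 : N) i < rep d i ->
    rep (0 : N) i = 0 -> [/\ A i y, y <> rep x i & `|y - rep x i| < rep d i].
  move=> i; have [[[_ hA] [r0 E]]|n] := pselect (drv (A i) (rep x i) /\
      rep (0 : N) i < rep d i /\ rep (0 : N) i = 0).
    by have [|y hy] := hA (rep d i); [rewrite -E|exists y].
  by exists 0 => h1 h2 h3; case: n.
have hh : ae U (fun i => [/\ A i (g i), g i <> rep x i & `|g i - rep x i| < rep d i]).
  have := proj2 (ae_and UU _ _) (conj hx (proj2 (ae_and UU _ _)
    (conj d0 (rep_cls UU (fun=> 0 : K))))).
  by apply: ae_imp => i [h1 [h2 h3]]; exact: (hg i h1 h2 h3).
exists (cls UU g); split.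
- by apply: ae_imp (proj2 (ae_and UU _ _) (conj hh (rep_cls UU g))) => i [[? _ _] ->].
- move=> E; have := rep_cls UU g; rewrite E => h.
  have := ae_exists UU (proj2 (ae_and UU _ _) (conj hh h)).
  by move=> [i [[_ ngx _] xg]]; apply: ngx.
- rewrite -[x]cls_rep -[d]cls_rep cls_dist; apply/cls_lt.
  by apply: ae_imp hh => i [].
Qed.

Lemma internal_iter_drv k A :
  internal (fun i => iter k (@drv K) (A i)) `<=` iter k (@drv N) (internal A).
Proof. by elim: k => //= k IH x /internal_drv; apply: sub_drv. Qed.

Lemma internal_no_interior A : (forall i a b, no_interior (A i) a b) ->
  forall a b, no_interior (internal A) a b.
Proof.
move=> iA a b p q _ /rep_lt pq _.
have /boolp.choice[g hg] : forall i, exists y, rep p i < rep q i ->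
    [/\ rep p i < y, y < rep q i & ~ A i y].
  move=> i; have [pqi|] := ltP (rep p i) (rep q i); last by exists 0.
  by have [//|//|y hy] := iA i (rep p i) (rep q i) (rep p i) (rep q i) _ pqi; exists y.
exists (cls UU g); split.
- by rewrite -[p]cls_rep; apply/cls_lt; apply: ae_imp pq => i /hg[].
- by rewrite -[q]cls_rep; apply/cls_lt; apply: ae_imp pq => i /hg[].
move=> h; have := proj2 (ae_and UU _ _) (conj pq (proj2 (ae_and UU _ _)
  (conj h (rep_cls UU g)))).
by move=> /(ae_exists UU)[i [/hg[_ _ nA] [+ E]]]; rewrite E.
Qed.

(** By the theorem of Los, the whole sequence [d] acts as a single parameter, its class. *)
Lemma internal_Dset (R : K -> K -> Prop) (d : nat -> K) : Drel e setT R ->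
  Dset (upower_expansion UU e) setT (internal (fun i => R (d i))).
Proof.
move=> [p _ Rp].
pose pN : pform L N := PForm (pbody p) (fun k => match @passign _ _ p k with
  | inl 0%N => inr (cls UU d) | inl _ => inl 0%N | inr a => inr (diag UU a) end).
exists pN => // v; rewrite /psat los.
have E : ae U (fun i => forall k, rep ((look id v \o @passign _ _ pN) k) i =
    (look id (scons (d i) (fun=> rep (v 0%N) i)) \o @passign _ _ p) k).
  apply: ae_forall => k /=; case: passign => [[|j]|a] /=.
  - exact: (rep_cls UU).
  - exact: (aeW UU).
  - exact: (rep_cls UU (fun=> a)).
split=> h; apply: ae_imp (proj2 (ae_and UU _ _) (conj h E)) => i [h' /funext E'].
  by have /Rp := h' : R (scons (d i) (fun=> rep (v 0%N) i) 0%N) _; rewrite /psat -E'; apply.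
by apply/(Rp (scons (d i) (fun=> rep (v 0%N) i))); rewrite /psat -E'.
Qed.

End Internal.

(* In an ultrapower over nat, members of unbounded rank would assemble to a
   definable set of infinite rank. *)
Lemma uniform_rank (R : K -> K -> Prop) : Drel e setT R ->
  (forall d a b, no_interior (R d) a b) ->
  exists k, forall d, iter k (@drv K) (R d) `<=` set0.
Proof.
move=> dR iR; apply: contrapT => h.
have /boolp.choice[d hd] : forall k, exists d, exists x, iter k (@drv K) (R d) x.
  move=> k; apply: contrapT => h'; apply: h; exists k => d x hx.
  by apply: h'; exists d, x.
(* The ultrafilter contains all final segments, so almost every index exceeds a given [k]. *)
have [U [UU UE]] := ultraFilterLemma eventually_filter.
have equivN : elementarily_equivalent e (upower_expansion UU e).
  exact: elementary_embedding_equiv (diag_elementary UU e).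
have [k hk] := rank_equiv equivN (internal_Dset UU d dR)
  (internal_no_interior (fun i => iR (d i))).
have /boolp.choice[g hg] := hd.
apply: (hk (cls UU g)); apply: internal_iter_drv.
have hU : ae U (fun i => (k <= i)%N) by apply: UE; exists k.
apply: ae_imp (proj2 (ae_and UU _ _) (conj hU (rep_cls UU g))) => i [ki ->].
have := hg i; rewrite -(subnK ki) iterD; exact: iter_drv_sub.
Qed.

End UniformRank.

Section Baire.
Variables (L : language) (K : realFieldType) (e : expansion L K).
Hypotheses (lubK : lub_property e) (rankK : finite_rank e).
Implicit Types (F : K -> set K).

Section DiscreteCover.
Variables (F : K -> set K) (a b : K).
Hypotheses (dF : Drel e setT F)
  (mF : forall d d' x, 0 < d' -> d' <= d -> F d x -> F d' x)
  (nF : forall d, 0 < d -> no_limit (F d) a b)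
  (covF : forall x, a < x -> x < b -> exists2 d, 0 < d & F d x).

(* x enters the increasing family before y, ties being broken by the order of
   K; every open interval has a least element for this order. *)
Let prec x y := (exists d, 0 < d /\ F d x /\ ~ F d y) \/
  ((forall d, 0 < d -> (F d x <-> F d y)) /\ x < y).

Let prec_total x y : x <> y -> prec x y \/ prec y x.
Proof.
move=> /eqP xy.
have [h|nxy] := pselect (exists d, 0 < d /\ F d x /\ ~ F d y); first by left; left.
have [h|nyx] := pselect (exists d, 0 < d /\ F d y /\ ~ F d x); first by right; left.
have E d : 0 < d -> (F d x <-> F d y).
  move=> d0; split=> h; apply: contrapT => h'; first by apply: nxy; exists d.
  by apply: nyx; exists d.
case: (ltgtP x y) xy => // xy _; [left|right]; right; split=> // d d0.
by rewrite (E d).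
Qed.

Let prec_irr x : ~ prec x x.
Proof. by case=> [[d [_ []]]|[_]]; rewrite ?ltxx. Qed.

Let prec_trans x y z : prec x y -> prec y z -> prec x z.
Proof.
move=> [[d [d0 [Fx nFy]]]|[E xy]] [[d' [d'0 [Fy nFz]]]|[E' yz]].
- left; exists d; split=> //; split=> // Fz.
  have [dd'|/ltW d'd] := leP d d'; first by apply: nFy; apply: mF Fy.
  by apply: nFz; apply: mF Fz.
- by left; exists d; split=> //; split=> // /E'; auto.
- by left; exists d'; split=> //; split=> //; apply/E.
- right; split; last exact: lt_trans yz.
  by move=> d d0; rewrite E // E'.
Qed.

(** Some stage [F d] contains the midpoint. It has no limit points, so its trace on the interval has
    a first element, and points outside this stage enter later. *)
Let prec_least p q : a <= p -> p < q -> q <= b ->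
  exists m, [/\ p < m, m < q & forall z, p < z -> z < q -> z <> m -> prec m z].
Proof.
move=> ap pq qb; have [||d d0 Fd] := covF (x := (p + q) / 2); [lra|lra|].
have dprec : Drel e setT prec by rewrite /prec; df.
have [|||||||m [[Fm [pm mq]] _ _ hm]] := no_limit_least lubK
  (E := [set x | F d x /\ p < x /\ x < q]) (R := prec) (a := p) (b := q).
- by df.
- by [].
- exact: ltW.
- exact: prec_trans.
- exact: prec_total.
- move=> t pt tq; have [||r r0 hr] := nF d0 (t := t); [lra|lra|].
  by exists r => // x [Fx _]; apply: hr.
- by exists ((p + q) / 2); split; [split=> //; lra|lra|lra].
exists m; split=> // z pz zq zm.
have [Fz|nFz] := pselect (F d z); last by left; exists d.
by apply: hm; [split|exact: ltW|exact: ltW|].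
Qed.

Lemma discrete_cover_false : a < b -> False.
Proof.
(* Here [l] and [r] are the nearest points on either side of [x] that precede it, and membership
   requires that [l] precede [r]. *)
move=> ab; pose A := [set x | exists l r, [/\ l < x, x < r & [/\ prec l x, prec r x,
  prec l r & forall z, l < z -> z < r -> z <> x -> prec x z]]].
have dprec : Drel e setT prec by rewrite /prec; df.
have dA : Dset e setT A.
  apply: (Df_ext (P := fun v => exists l r, l < v 0%N /\ v 0%N < r /\ prec l (v 0%N) /\
    prec r (v 0%N) /\ prec l r /\ forall z, l < z -> z < r -> z <> v 0%N ->
    prec (v 0%N) z)) => [v|].
    split=> -[l [r]]; first by move=> [? [? [? [? [? ?]]]]]; exists l, r.
    by move=> [? ? [? ? ? ?]]; exists l, r.
  by df.
have asym x y : prec x y -> prec y x -> False.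
  by move=> h1 h2; apply: (prec_irr (prec_trans h1 h2)).
have codense : no_interior A a b.
  move=> p q ap pq qb.
  (* Taking first points successively to the left of [x0] and then between [x1] and [x0] gives a
     point whose right predecessor [x0] precedes its left one [x1]. *)
  have [x0 [px0 x0q h0]] := prec_least ap pq qb.
  have [|x1 [px1 x1x0 h1]] := prec_least ap px0; first lra.
  have [|||x2 [x1x2 x2x0 h2]] := prec_least (p := x1) (q := x0); try lra.
  exists x2; split; try lra.
  move=> [l [r [lx2 x2r [plx2 prx2 plr hmin]]]].
  have P1 : prec x0 x1 by apply: h0 => //; lra.
  have P2 : prec x1 x2 by apply: h1 => //; lra.
  have P3 : prec x0 x2 by apply: h0 => //; lra.
  have lE : l = x1.
    case: (ltgtP l x1) => // lx1.
      by exfalso; apply: (asym _ _ P2); apply: hmin; lra.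
    by exfalso; apply: (asym _ _ plx2); apply: h2; lra.
  have rE : r = x0.
    case: (ltgtP r x0) => // rx0.
      by exfalso; apply: (asym _ _ prx2); apply: h2; lra.
    by exfalso; apply: (asym _ _ P3); apply: hmin; lra.
  by apply: (asym _ _ P1); rewrite -lE -rE.
have [p [q [ap pq qb nA]]] := nowhere_dense rankK dA ab codense.
(* The mirror construction, to the right of [x0], gives a point of [A] in the supposed gap. *)
have [x0 [px0 x0q h0]] := prec_least ap pq qb.
have [|||x1 [x0x1 x1q h1]] := prec_least (p := x0) (q := q); try lra.
have [|||x2 [x0x2 x2x1 h2]] := prec_least (p := x0) (q := x1); try lra.
apply: (nA x2); try lra.
exists x0, x1; split=> //; split=> //; [apply: h0|apply: h1|apply: h0]; lra.
Qed.

End DiscreteCover.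

(** Induction on the rank. If the union of the derivatives has interior, they cover a smaller
    interval with rank one less; otherwise they all miss some interval, on which the members have no
    limit points. *)
Lemma closed_cover_false k F a b : Drel e setT F -> a < b ->
  (forall d, 0 < d -> closed_set (F d)) ->
  (forall d d' x, 0 < d' -> d' <= d -> F d x -> F d' x) ->
  (forall d, 0 < d -> iter k (@drv K) (F d) `<=` set0) ->
  (forall x, a < x -> x < b -> exists2 d, 0 < d & F d x) -> False.
Proof.
elim: k F a b => [|k IH] F a b dF ab cF mF rF covF.
  have [||d d0 /(rF d d0)//] := covF ((a + b) / 2); lra.
have dF' : Drel e setT (fun d => drv (F d)).
  apply: (Df_ext (P := fun v => F (v 0%N) (v 1%N) /\ forall d, 0 < d ->
    exists y, F (v 0%N) y /\ y <> v 1%N /\ `|y - v 1%N| < d)) => [v|]; last by df.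
  split=> -[Fv h]; split=> // d /h[y]; first by move=> [? []]; exists y.
  by move=> [? ? ?]; exists y.
have [iG|nG] := pselect (no_interior [set x | exists d, 0 < d /\ drv (F d) x] a b).
  have [|p [q [ap pq qb nG]]] := nowhere_dense rankK _ ab iG; first by df.
  (* A middle third, because [no_limit] also concerns the endpoints. *)
  apply: (@discrete_cover_false F ((2 * p + q) / 3) ((p + 2 * q) / 3)) => //; try lra.
    move=> d d0 t pt tq; apply: contrapT => h; apply: (nG t); try lra.
    exists d; split=> //.
    have hd r : 0 < r -> exists y, [/\ F d y, y <> t & `|y - t| < r].
      move=> r0; apply: contrapT => h'; apply: h; exists r => // y Fy yt.
      by apply: contrapT => nyt; apply: h'; exists y.
    by split=> //; apply: cF => // r /hd[y [? _ ?]]; exists y.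
  by move=> x px xq; apply: covF; lra.
apply: nG => p q ap pq qb; apply: contrapT => h.
apply: (IH (fun d => drv (F d)) p q) => //.
- by move=> d d0; apply: drv_closed; apply: cF.
- by move=> d d' x d'0 d'd; apply: sub_drv => y; apply: mF.
- by move=> d d0; rewrite -iterSr; apply: rF.
move=> x px xq; apply: contrapT => h'; apply: h; exists x; split=> // -[d [d0 ?]].
by apply: h'; exists d.
Qed.

Hypothesis rank_equiv : forall (K' : realFieldType) (e' : expansion L K'),
  elementarily_equivalent e e' -> finite_rank e'.

(** If no member contained an interval, the closures of the members would have no interior, hence
    uniformly bounded rank, and could not cover. *)
Lemma definable_baire F a b : Drel e setT F -> a < b ->
  (forall d d' x, 0 < d' -> d' <= d -> F d x -> F d' x) ->
  (forall x, a < x -> x < b -> exists2 d, 0 < d & F d x) ->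
  exists d p q, [/\ 0 < d, a <= p, p < q, q <= b & forall x, p < x -> x < q -> F d x].
Proof.
move=> dF ab mF covF; apply: contrapT => h.
pose G d := [set x | F d x /\ a < x /\ x < b].
(* The family is controlled for positive [d] only, whereas [uniform_rank] concerns all [d]; so [E d]
   is made empty for the others. *)
pose E d := [set x | 0 < d /\ cl (G d) x].
have dE : Drel e setT E.
  apply: (Df_ext (P := fun v => 0 < v 0%N /\ forall r, 0 < r -> exists y,
    (F (v 0%N) y /\ a < y /\ y < b) /\ `|y - v 1%N| < r)) => [v|]; last by df.
  by split=> -[v0 hv]; split=> // r /hv[y]; [move=> []|]; exists y.
have iE d c c' : no_interior (E d) c c'.
  move=> p q _ pq _; apply: contrapT => nE.
  have pqE x : p < x -> x < q -> E d x.
    by move=> px xq; apply: contrapT => nEx; apply: nE; exists x.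
  have [||d0 _] := pqE ((p + q) / 2); [lra|lra|].
  have [|||p' [q' [pp' p'q' q'q nG]]] := nowhere_dense rankK (A := G d) (a := p) (b := q).
  - by rewrite /G; df.
  - by [].
  - move=> p1 q1 pp1 p1q1 q1q; apply: contrapT => nG.
    have G1 x : p1 < x -> x < q1 -> G d x.
      by move=> px xq; apply: contrapT => nGx; apply: nG; exists x.
    apply: h; exists d, ((2 * p1 + q1) / 3), ((p1 + 2 * q1) / 3); split=> //.
    + by have [||_ []] := G1 ((2 * p1 + q1) / 3); lra.
    + by lra.
    + by have [||_ []] := G1 ((p1 + 2 * q1) / 3); lra.
    + by move=> x px xq; have [||//] := G1 x; lra.
  have [||_] := pqE ((p' + q') / 2); [lra|lra|].
  move=> /(_ ((q' - p') / 2))[|y Gy]; first lra.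
  by rewrite ltr_norml => hy; apply: (nG y) => //; lra.
have [k hk] := uniform_rank rank_equiv dE iE.
apply: (@closed_cover_false k E a b) => //.
- move=> d d0 x clx; split=> //; apply: cl_closed => r /clx[y [_ Ey]].
  by exists y.
- move=> d d' x d'0 d'd [_ clx]; split=> // r /clx[y [Fy yab] yx].
  by exists y => //; split=> //; apply: mF Fy.
- move=> x ax xb; have [d d0 Fx] := covF x ax xb.
  by exists d => //; split=> //; apply: sub_cl.
Qed.

End Baire.

(** * Elements definable from a Cauchy cut *)

Section CutExtension.
Variables (L : language) (K : realFieldType) (e : expansion L K).
Hypotheses (lubK : lub_property e)
  (rank_equiv : forall (K' : realFieldType) (e' : expansion L K'),
     elementarily_equivalent e e' -> finite_rank e').
Variables (M : set K) (c : K).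
Hypotheses (TV : tarski_vaught e M) (cutc : cauchy_cut M c).

Let rankK : finite_rank e.
Proof. exact: rank_equiv (elementarily_equivalent_refl e). Qed.

(** The set [B] of points near which [P] holds uniformly meets every interval inside [A]. Since the
    cut of [c] decides [B], it contains a whole interval around [c]; compactness gives a common [d]
    there, and Tarski-Vaught puts it in [M]. *)
Lemma cut_uniform (A : set K) (P : K -> K -> Prop) : Dset e M A -> A c ->
  Drel e M P -> (forall u d d', 0 < d' -> d' <= d -> P u d -> P u d') ->
  (forall a b, a < b -> (forall x, a < x -> x < b -> A x) -> exists t d,
     [/\ a < t, t < b, 0 < d & forall u, `|u - t| < d -> P u d]) ->
  exists d, [/\ M d, 0 < d & P c d].
Proof.
move=> dA Ac dP mP hP; have dPT : Drel e setT P by apply: DfS dP.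
pose B := [set t | exists d, 0 < d /\ forall u, `|u - t| < d -> P u d].
have dB : Dset e M B by rewrite /B; df.
have Bc : B c.
  apply: contrapT => nBc.
  have [||a [b [_ _ ac cb hab]]] := cut_interval lubK rankK TV cutc
    (A := [set x | A x /\ ~ B x]); [by df|by []|].
  have [|x ax xb|t [d [at' tb d0 hd]]] := hP a b; first lra.
    by case: (hab x ax xb).
  by case: (hab t at' tb) => _; apply; exists d.
have [a [b [Ma Mb ac cb hab]]] := cut_interval lubK rankK TV cutc dB Bc.
have [a' [b' [Ma' Mb' aa' a'c [cb' b'b _]]]] :=
  cut_shrink TV cutc Ma Mb ac cb (tv_nat TV 1) ltr01.
have [d Md [d0 hd]] : exists2 d, M d & 0 < d /\ forall u, a' <= u -> u <= b' -> P u d.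
  apply: (@TV [set d | 0 < d /\ forall u, a' <= u -> u <= b' -> P u d]); first by df.
  have [|//|t at' tb|d d0 hd] := uniform_on_interval lubK dPT (a := a') (b := b').
  - lra.
  - have [||d [d0 hd]] := hab t; [lra|lra|].
    by exists d => // u _ _; apply: hd.
  by exists d.
by exists d; split=> //; apply: hd; lra.
Qed.

(** [y] is the value at [c] of a function definable over [M], with graph [R]. Small oscillation near
    [c] lets a value at a nearby point of [M] approximate [y]; a local lower bound on absolute
    values keeps a nonzero [y] away from 0. *)
Lemma dcl_cut y : dcl e (M `|` [set c]) y ->
  (forall r, M r -> 0 < r -> exists2 z, M z & `|y - z| < r) /\
  (y <> 0 -> exists r, [/\ M r, 0 < r & r <= `|y|]).
Proof.
move=> /Dset_param[R dR Ry].
have dRT : Drel e setT R by apply: DfS dR.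
have Rc : R c y by apply/Ry.
have Ru z : R c z -> z = y by move=> /Ry.
pose fn := [set x | (exists z, R x z) /\ forall z z', R x z -> R x z' -> z = z'].
have dfn : Dset e M fn by rewrite /fn; df.
have fnc : fn c by split=> [|z z' /Ru -> /Ru ->]; first by exists y.
split=> [r Mr r0|y0].
- have [|||d [Md d0 hd]] := cut_uniform dfn fnc (P := fun u d =>
    forall u', `|u' - u| < d -> forall z z', R u z -> R u' z' -> `|z - z'| < r).
  + by df.
  + by move=> u d d' d'0 d'd h u' u'u; apply: h; lra.
  + move=> a b ab fab.
    (* By the Baire property the function is bounded by [d^-1] on a subinterval. *)
    have [|||d [p [q [d0 ap pq qb hd]]]] := definable_baire lubK rankK rank_equiv
      (F := fun d x => forall z, R x z -> `|z| * d <= 1) (a := a) (b := b) _ ab.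
    * by df.
    * move=> d d' x d'0 d'd h z /h; apply: le_trans.
      by apply: ler_wpM2l.
    * move=> x ax xb; have [[z Rz] Rzu] := fab x ax xb.
      exists (`|z| + 1)^-1; first by rewrite invr_gt0; have := normr_ge0 z; lra.
      move=> z' /(Rzu _ _ Rz) <-; rewrite ler_pdivrMr ?mul1r; last first.
        by have := normr_ge0 z; lra.
      lra.
    have bd x z : p < x -> x < q -> R x z -> `|z| <= d^-1.
      by move=> px xq /(hd x px xq); rewrite -[_^-1]mul1r ler_pdivlMr.
    (* Upper bounds of the function on subintervals; their infimum [w] cannot be improved by
       shrinking the interval. *)
    pose T := [set w | exists p' q', p <= p' /\ p' < q' /\ q' <= q /\
      forall x, p' < x -> x < q' -> forall z, R x z -> z <= w].
    have [|||w uw lw] := glb lubK (A := T).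
    * by rewrite /T; df.
    * exists d^-1, p, q; do !split=> //; move=> x px xq z /(bd x z px xq).
      by rewrite ler_norml => /andP[].
    * exists (- d^-1) => w [p' [q' [pp' [p'q' [q'q hw]]]]].
      have [||[z Rz] _] := fab ((p' + q') / 2); [lra|lra|].
      have := bd ((p' + q') / 2) z; have := hw ((p' + q') / 2) _ _ z Rz.
      rewrite ler_norml; move=> h1 h2.
      have h3 : z <= w by apply: h1; lra.
      have /andP[h4 _] : (- d^-1 <= z) && (z <= d^-1) by apply: h2 => //; lra.
      lra.
    have [w' [p1 [q1 [pp1 [p1q1 [q1q hw']]]]] w'w] : exists2 w', T w' & w' < w + r / 4.
      apply: contrapT => h; have : w + r / 4 <= w; last by lra.
      by apply: lw => w' Tw'; rewrite leNgt; apply/negP => hw; apply: h; exists w'.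
    (* Values at most [w - r / 4] throughout an interval would contradict the choice of [w]. Some
       smaller interval avoids such values, and there the oscillation is at most [r / 2]. *)
    have [||p2 [q2 [p1p2 p2q2 q2q1 h2]]] := nowhere_dense rankK
      (A := [set x | exists z, R x z /\ z <= w - r / 4]) _ p1q1.
    * by df.
    * move=> p2 q2 p1p2 p2q2 q2q1; apply: contrapT => h.
      have : w <= w - r / 4; last by lra.
      apply: uw; exists p2, q2; split; first lra; split=> //; split; first lra.
      move=> x p2x xq2 z Rz; rewrite leNgt; apply/negP => wz; apply: h; exists x.
      split=> // -[z' [Rz' z'w]].
      have [||_ /(_ _ _ Rz Rz') E] := fab x; [lra|lra|].
      by move: wz; rewrite E; lra.
    (* A quarter of the length, so that [u] and then [u'] stay in the interval. *)
    exists ((p2 + q2) / 2), ((q2 - p2) / 4); split; try lra.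
    move=> u; rewrite ltr_norml => hu u'; rewrite ltr_norml => hu' z z' Rz Rz'.
    have hz x t : p2 < x -> x < q2 -> R x t -> w - r / 4 < t /\ t <= w + r / 4.
      move=> p2x xq2 Rt; split; last by have := hw' x _ _ t Rt; lra.
      by rewrite ltNge; apply/negP => tw; apply: (h2 x p2x xq2); exists t.
    have [h3 h4] : w - r / 4 < z /\ z <= w + r / 4 by apply: (hz u) => //; lra.
    have [h5 h6] : w - r / 4 < z' /\ z' <= w + r / 4 by apply: (hz u') => //; lra.
    by rewrite ltr_norml; lra.
  have [a [b [Ma Mb ac cb fab]]] := cut_interval lubK rankK TV cutc dfn fnc.
  have [x [b' [Mx _ ax xc [cb' b'b xb']]]] := cut_shrink TV cutc Ma Mb ac cb Md d0.
  have [||[z0 Rz0] _] := fab x; [lra|lra|].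
  have [||z Mz Rz] := TV (A := [set z | R x z]); [by df|by exists z0|].
  exists z => //; apply: (hd x) => //; rewrite ltr_norml; lra.
have [|||||r [Mr r0 hr]] := cut_uniform (A := [set x | fn x /\ forall z, R x z -> z <> 0])
  (P := fun u d => forall z, R u z -> d <= `|z|).
- by have dfn' := dfn; df.
- by split=> // z /Ru ->.
- by df.
- by move=> u d d' d'0 d'd h z /h; apply: le_trans.
- move=> a b ab fab.
  have [|||d [p [q [d0 ap pq qb hd]]]] := definable_baire lubK rankK rank_equiv
    (F := fun d x => forall z, R x z -> d <= `|z|) (a := a) (b := b) _ ab.
  + by df.
  + by move=> d d' x d'0 d'd h z /h; apply: le_trans.
  + move=> x ax xb; have [[[z Rz] Rzu] nz] := fab x ax xb.
    exists (`|z|) => [|z' /(Rzu _ _ Rz) <- //].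
    by rewrite normr_gt0; apply/eqP/nz.
  exists ((p + q) / 2), (Num.min d ((q - p) / 2)); split; try lra.
    by rewrite lt_min d0 /=; lra.
  move=> u; rewrite lt_min => /andP[_]; rewrite ltr_norml => hu z Rz.
  have : d <= `|z| by apply: (hd u) => //; lra.
  by apply: le_trans; rewrite ge_min lexx.
by exists r; split=> //; apply: hr.
Qed.

End CutExtension.

(** * Existence *)

Section ElementaryFacts.
Variables (L : language) (K N : realFieldType) (e : expansion L K) (eN : expansion L N).
Variable d : K -> N.
Hypothesis elem : elementary_embedding e eN d.

Lemma elementary_psat (p : pform L K) v : psat e id p v <-> psat eN d p (d \o v).
Proof.
rewrite /psat elem; suff -> : d \o (look id v \o @passign _ _ p) =
  look d (d \o v) \o @passign _ _ p by [].
by apply/funext => k /=; case: passign.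
Qed.

Lemma tarski_vaught_range : tarski_vaught eN (range d).
Proof.
move=> A [p pX Ap] [x Ax].
have /boolp.choice[pre preP] : forall y, exists a, range d y -> d a = y.
  by move=> y; have [[a _ <-]|n] := pselect (range d y); [exists a|exists 0].
pose q : pform L K := PForm (pbody p) (fun k => match @passign _ _ p k with
  | inl j => inl j | inr a => inr (pre a) end).
have qp v : psat eN d q v <-> psat eN id p v.
  rewrite /psat /=; suff -> : look d v \o @passign _ _ q = look id v \o @passign _ _ p by [].
  by apply/funext => k /=; case E: passign => [|a] //=; apply: preP; apply: pX E.
have : psat eN d (pex q) (d \o (fun=> 0)).
  by rewrite psat_ex; exists x; apply/qp/(Ap (scons x _)).
rewrite -elementary_psat psat_ex => -[a /elementary_psat/qp/Ap Aa].
by exists (d a) => //; exists a.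
Qed.

End ElementaryFacts.

(** * Maximal elementary submodels in which K is dense *)

Section DenseSubmodel.
Variables (L : language) (K N : realFieldType) (eN : expansion L N).
Variable (d : {rmorphism K -> N}).
Hypotheses (lubN : lub_property eN)
  (rank_equiv : forall (N' : realFieldType) (e' : expansion L N'),
     elementarily_equivalent eN e' -> finite_rank e').
Hypotheses (d_mono : {mono d : x y / x <= y}) (TV0 : tarski_vaught eN (range d)).

Let d_lt : {mono d : x y / x < y} := leW_mono d_mono.

Let d_gt0 r : (0 < d r) = (0 < r).
Proof. by rewrite -(rmorph0 d) d_lt. Qed.

Let rankN : finite_rank eN.
Proof. exact: rank_equiv (elementarily_equivalent_refl eN). Qed.

(* An elementary substructure of N containing K, in which K is dense. *)
Definition dense_submodel (M : set N) :=
  [/\ range d `<=` M, tarski_vaught eN M,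
      (forall y, M y -> forall r, 0 < r -> exists a, `|y - d a| < d r) &
      (forall y, M y -> y <> 0 -> exists2 r, 0 < r & d r <= `|y|)].

Lemma dense_submodel_range : dense_submodel (range d).
Proof.
split=> // [_ [a _ <-] r r0|_ [a _ <-] a0].
  by exists a; rewrite subrr normr0 d_gt0.
have [ap|an] := leP 0 a.
  exists a; last by rewrite ger0_norm // -(rmorph0 d) d_mono.
  by rewrite lt_def ap andbT; apply/eqP => E; apply: a0; rewrite E rmorph0.
exists (- a); first by rewrite oppr_gt0.
by rewrite ltr0_norm ?rmorphN // -(rmorph0 d) d_lt.
Qed.

Lemma dense_submodel_max : exists M, dense_submodel M /\
  forall M', M `<=` M' -> dense_submodel M' -> M' `<=` M.
Proof.
have [|M [PM maxM]] := @Zorn_bigcup N [set M | M = set0 \/ dense_submodel M].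
  move=> F FP tF.
  have [[X0 [FX0 dX0]]|nF] := pselect (exists X, F X /\ dense_submodel X); last first.
    left; rewrite -subset0 => y [X FX Xy]; case: (FP _ FX) => [X0|dX].
      by move: Xy; rewrite X0.
    by case: nF; exists X.
  right; pose F' := [set X | F X /\ dense_submodel X].
  have F'E : \bigcup_(X in F) X = \bigcup_(X in F') X.
    apply/seteqP; split=> y [X FX Xy]; last by exists X => //; case: FX.
    by exists X => //; split=> //; case: (FP _ FX) => // E; move: Xy; rewrite E.
  have tF' : total_on F' subset by move=> X Y [FX _] [FY _]; apply: tF.
  rewrite F'E; split.
  - by move=> y dy; exists X0 => //; case: dX0 => h _ _ _; apply: h.
  - move=> A dA nA; have [X F'X dA'] := Df_chain (ex_intro _ X0 (conj FX0 dX0)) tF' dA.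
    case: (F'X) => FX [_ TV _ _]; have [y Xy Ay] := TV A dA' nA.
    by exists y => //; exists X.
  - by move=> y [X [FX [_ _ h _]] Xy]; apply: h.
  - by move=> y [X [FX [_ _ _ h]] Xy]; apply: h.
have dM : dense_submodel M.
  case: PM => // M0; exfalso; apply: (maxM (range d)); last by right; exact: dense_submodel_range.
  by rewrite M0; split=> // /(_ (d 0)); apply; exists 0.
exists M; split=> // M' MM' dM'; apply: contrapT => h.
by apply: (maxM M'); [split|right].
Qed.

Variable M : set N.
Hypothesis dM : dense_submodel M.

Let MK a : M (d a). Proof. by case: dM => h _ _ _; apply: h; exists a. Qed.
Let TV : tarski_vaught eN M. Proof. by case: dM. Qed.

(** Definable choice makes the definable closure an elementary substructure, and [dcl_cut] shows
    that K still approximates all its elements and that no new infinitesimals appear. *)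
Lemma dense_submodel_extend s :
  (forall r, 0 < r -> exists a, `|s - d a| < d r) ->
  (forall y, M y -> exists2 r, 0 < r & d r <= `|s - y|) ->
  dense_submodel (dcl eN (M `|` [set s])).
Proof.
case: dM => _ _ appM posM apps seps.
have cuts : cauchy_cut M s.
  split=> [r Mr r0|b Mb].
    have [|r' r'0 hr'] := posM r Mr; first by apply/eqP; rewrite gt_eqF.
    have [a ha] := apps r' r'0; exists (d a) => //; apply: lt_le_trans ha _.
    by rewrite -(gtr0_norm r0).
  by have [r r0 hr] := seps b Mb; exists (d r); rewrite d_gt0.
have sub : M `<=` dcl eN (M `|` [set s]) by move=> y My; apply: sub_dcl; left.
split.
- by move=> _ [a _ <-]; apply: sub.
- move=> A /Df_dcl dA nA; have [y Ay dy] := dcl_choice lubN rankN dA nA.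
  by exists y.
- move=> y /(dcl_cut lubN rank_equiv TV cuts)[appy _] r r0.
  have r20 : 0 < r / 2 by rewrite divr_gt0.
  have [|z Mz yz] := appy (d (r / 2)) (MK _); first by rewrite d_gt0.
  have [a za] := appM z Mz _ r20; exists a.
  rewrite -(subrKA z); apply: le_lt_trans (ler_normD _ _) _.
  by rewrite (splitr r) rmorphD ltrD.
move=> y /(dcl_cut lubN rank_equiv TV cuts)[_ h] /h[r [Mr r0 ry]].
have [|r' r'0 hr'] := posM r Mr; first by apply/eqP; rewrite gt_eqF.
by exists r' => //; apply: le_trans ry; rewrite -(gtr0_norm r0).
Qed.

Lemma submodel_eq y z : M y -> M z -> (forall r, 0 < r -> `|y - z| < d r) -> y = z.
Proof.
move=> My Mz h; apply: contrapT => yz; have [_ _ _ posM] := dM.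
have [||r r0] := posM (y - z); first exact: (tv_sub TV).
  by move/eqP; rewrite subr_eq0 => /eqP.
by rewrite leNgt h.
Qed.

Lemma submodel_fun f w : (forall k, M (w k)) -> M (@finterp L N eN f w).
Proof.
move=> Mw; apply: (tv_dcl TV).
exists (PForm (FEq (TVar L ord0) (@TFun L _ f (fun k => TVar L (lift ord0 k))))
  (env_cons (inl 0%N) (fun k => inr (w k)))).
  move=> k a /=; case: (unliftP ord0 k) => [j|] ->; rewrite ?env_cons0 // env_consS.
  by move=> [<-].
move=> v; rewrite /psat /= env_cons0; suff -> : (fun k =>
  look id v (env_cons (inl 0%N) (fun k => inr (w k)) (lift ord0 k))) = w by [].
by apply/funext => k; rewrite env_consS.
Qed.

Lemma submodel_ex n (phi : formula L n.+1) w x : (forall k, M (w k)) ->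
  sat eN (env_cons x w) phi -> exists2 y, M y & sat eN (env_cons y w) phi.
Proof.
move=> Mw hx; apply: (TV (A := [set y | sat eN (env_cons y w) phi])); last by exists x.
exists (PForm phi (env_cons (inl 0%N) (fun k => inr (w k)))).
  move=> k a /=; case: (unliftP ord0 k) => [j|] ->; rewrite ?env_cons0 // env_consS.
  by move=> [<-].
move=> v; rewrite /psat /=; suff -> : look id v \o
  env_cons (inl 0%N) (fun k => inr (w k)) = env_cons (v 0%N) w by [].
by apply/funext => k /=; case: (unliftP ord0 k) => [j|] ->; rewrite ?env_cons0 ?env_consS.
Qed.

(* Only the additive order structure of M is needed to invoke the maximality of
   the Cauchy completion. *)
Definition in_submodel : {pred N} := fun y => `[< M y >].

Fact in_submodel_zmod : zmod_closed in_submodel.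
Proof.
split; first by apply/asboolP; rewrite -(rmorph0 d).
by move=> y z /asboolP My /asboolP Mz; apply/asboolP/(tv_sub TV).
Qed.

HB.instance Definition _ := GRing.isZmodClosed.Build N in_submodel in_submodel_zmod.

Definition submodel := {y : N | y \in in_submodel}.
HB.instance Definition _ := SubChoice.on submodel.
HB.instance Definition _ := [SubChoice_isSubZmodule of submodel by <:].
HB.instance Definition _ := [SubChoice_isSubPOrder of submodel by <: with ring_display].

Variables (C : realFieldType) (i : {rmorphism K -> C}).
Hypothesis complC : is_cauchy_completion i.

Let i_mono : {mono i : x y / x <= y}. Proof. by case: complC. Qed.
Let i_lt : {mono i : x y / x < y} := leW_mono i_mono.
Let i_dense : order_dense i. Proof. by case: complC. Qed.

(** [y] and [c] lie in different fields and are compared through the cuts they make in [K]. *)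
Definition near (y : N) (c : C) :=
  forall a, (i a < c -> d a < y) /\ (c < i a -> y < d a).

Lemma dense_approx (c : C) r : 0 < r -> exists2 a, c < i a & i (a - r) < c.
Proof.
move=> r0; have [|a /andP[ca ac]] := @i_dense c (c + i r).
  by rewrite ltrDl -(rmorph0 i) i_lt.
by exists a => //; rewrite rmorphB ltrBlDr.
Qed.

Lemma near_approx y c r : near y c -> 0 < r -> exists a, `|y - d a| < d r.
Proof.
move=> yc r0; have [a ca ac] := dense_approx c r0; exists a.
have [_ /(_ ca)] := yc a; have [/(_ ac) + _] := yc (a - r).
by rewrite rmorphB ltr_norml; lra.
Qed.

Lemma near_dist y z c r : near y c -> near z c -> 0 < r -> `|y - z| < d r.
Proof.
move=> yc zc r0; have [a ca ac] := dense_approx c r0.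
have [_ /(_ ca)] := yc a; have [/(_ ac) + _] := yc (a - r).
have [_ /(_ ca)] := zc a; have [/(_ ac) + _] := zc (a - r).
by rewrite rmorphB ltr_norml; lra.
Qed.

Lemma near_close y z c : near y c -> (forall r, 0 < r -> `|y - z| < d r) -> near z c.
Proof.
move=> yc yz a; split=> ac.
  have [b /andP[]] := i_dense ac; rewrite i_lt => ab bc.
  have [/(_ bc) + _] := yc b; have := yz (b - a).
  by rewrite subr_gt0 => /(_ ab); rewrite rmorphB ltr_norml; lra.
have [b /andP[cb]] := i_dense ac; rewrite i_lt => ba.
have [_ /(_ cb)] := yc b; have := yz (a - b).
by rewrite subr_gt0 => /(_ ba); rewrite rmorphB ltr_norml; lra.
Qed.

Hypothesis maxM : forall M', M `<=` M' -> dense_submodel M' -> M' `<=` M.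
Hypothesis realize : forall c, exists s, near s c.

(** If no point of [M] were near [c], a realization of [c] in [N] could be adjoined to [M], against
    maximality. *)
Lemma near_submodel c : exists y, M y /\ near y c.
Proof.
apply: contrapT => nc; have [s sc] := realize c.
have Ms : M s.
  apply: (@maxM (dcl eN (M `|` [set s]))); last by apply: sub_dcl; right.
    by move=> y My; apply: sub_dcl; left.
  apply: dense_submodel_extend => [r|y My]; first exact: near_approx.
  apply: contrapT => h; apply: nc; exists y; split=> //; apply: near_close sc _.
  by move=> r r0; rewrite ltNge; apply/negP => hr; apply: h; exists r.
by apply: nc; exists s.
Qed.

(** [g c] is the only point of [M] near [c], whence additivity and monotonicity. Surjectivity onto
    [M] is the maximality of the completion, applied to [M] as an ordered group in which [K] is
    dense. *)
Lemma submodel_iso : exists g : C -> N, [/\ forall c, near (g c) c,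
  forall y, M y <-> exists c, g c = y, forall a, g (i a) = d a,
  forall c c', g (c + c') = g c + g c' & {mono g : x y / x < y}].
Proof.
have /boolp.choice[g hg] := near_submodel.
have gM c : M (g c) by case: (hg c).
have gn c : near (g c) c by case: (hg c).
have g_uniq y c : M y -> near y c -> y = g c.
  by move=> My yc; apply: submodel_eq => // r; apply: near_dist yc (gn c).
have gi a : g (i a) = d a.
  by symmetry; apply: g_uniq => // b; rewrite !i_lt !d_lt.
have gD c c' : g (c + c') = g c + g c'.
  symmetry; apply: g_uniq; first exact: (tv_add TV).
  move=> a; split=> ac.
    have [|p /andP[p1 p2]] := @i_dense (i a - c') c; first by rewrite ltrBlDr.
    have [/(_ p2) + _] := gn c p; have [+ _] := gn c' (a - p).
    by rewrite !rmorphB ltrBlDr addrC -ltrBlDr => /(_ p1); lra.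
  have [|p /andP[p1 p2]] := @i_dense c (i a - c'); first by rewrite ltrBrDr.
  have [_ /(_ p1)] := gn c p; have [_] := gn c' (a - p).
  by rewrite !rmorphB ltrBrDr addrC -ltrBrDr => /(_ p2); lra.
have g_le : {mono g : x y / x <= y}.
  apply: le_mono => c c' cc'.

  have [p /andP[cp pc']] := i_dense cc'.
  by have [_ /(_ cp)] := gn c p; have [/(_ pc') + _] := gn c' p; lra.
have g_lt : {mono g : x y / x < y} := leW_mono g_le.
exists g; split=> // y; split=> [My|[c <-] //].
have gP c : g c \in in_submodel by apply/asboolP.
pose j c : submodel := Sub (g c) (gP c).
have jE c : val (j c) = g c by exact: SubK.
have jB : zmod_morphism j.
  move=> c c'; apply: val_inj; rewrite [RHS]raddfB !jE.
  by apply/eqP; rewrite eq_sym subr_eq -gD subrK.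
pose jA : {additive C -> submodel} := HB.pack j (GRing.isZmodMorphism.Build C submodel j jB).
have yP : y \in in_submodel by apply/asboolP.
have [_ _ maxC] := complC.
have [|||c jc] := maxC submodel jA _ _ _ (Sub y yP).
- split=> [u v|u v w uv]; first exact: le_total (val u) (val v).
  rewrite -[_ <= _]/(val (w + u) <= val (w + v)) !raddfD lerD2l.
  exact: uv.
- move=> c c'; rewrite -[LHS]/(val (j c) <= val (j c')) !jE.
  exact: g_le.
- move=> u v uv; have [_ _ appM posM] := dM.
  have Mv (w : submodel) : M (val w) by case: w => z zP; apply/asboolP; exact: zP.
  have uv' : val u < val v by exact: uv.
  have [||r r0 hr] := posM (val v - val u); first exact: (tv_sub TV).
    by move/eqP; rewrite subr_eq0 gt_eqF.
  (* A point of [K] within [d r / 2] of the midpoint lies between [u] and [v], which are at least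
     [d r] apart. *)
  have Mm : M ((val u + val v) / 2%:R) by apply: (tv_divn TV); apply: (tv_add TV).
  have [|a] := appM _ Mm (r / 2); first lra.
  rewrite fmorph_div rmorph_nat ltr_norml => ha; exists a.
  move: hr; rewrite gtr0_norm ?subr_gt0 // => hr.
  rewrite -[_ < jA _]/(val u < val (j (i a))) -[jA _ < _]/(val (j (i a)) < val v).
  rewrite jE gi; lra.
by exists c; rewrite -jE -[j c]/(jA c) jc SubK.
Qed.

End DenseSubmodel.

Lemma mul_approx (F : realFieldType) (x y a b B r : F) :
  `|x| <= B -> `|y| <= B -> `|x - a| <= r -> `|y - b| <= r -> r <= 1 ->
  `|x * y - a * b| <= r * (2 * B + 1).
Proof.
move=> xB yB xa yb r1.
have b1 : `|b| <= B + 1.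
  rewrite -[b](subKr y); apply: le_trans (ler_normB _ _) _; lra.
have -> : x * y - a * b = x * (y - b) + b * (x - a) by ring.
apply: le_trans (ler_normD _ _) _; rewrite !normrM.
have h1 : `|x| * `|y - b| <= B * r by apply: ler_pM.
have h2 : `|b| * `|x - a| <= (B + 1) * r by apply: ler_pM.
lra.
Qed.

(** * Transport of the structure to the completion *)

Section Transport.
Variables (L : language) (K N C : realFieldType) (e : expansion L K) (eN : expansion L N).
Variables (d : {rmorphism K -> N}) (i : {rmorphism K -> C}) (M : set N) (g : C -> N).
Hypotheses (d_mono : {mono d : x y / x <= y}) (elem : elementary_embedding e eN d)
  (dM : dense_submodel eN d M) (complC : is_cauchy_completion i).
Hypotheses (gM : forall y, M y <-> exists c, g c = y) (gi : forall a, g (i a) = d a)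
  (gD : forall c c', g (c + c') = g c + g c') (g_lt : {mono g : x y / x < y}).

Let i_mono : {mono i : x y / x <= y}. Proof. by case: complC. Qed.

Let TV : tarski_vaught eN M. Proof. by case: dM. Qed.

Lemma iso_dist c a r : `|c - i a| < i r -> `|g c - d a| < d r.
Proof.
rewrite !ltr_norml !ltrBlDr !ltrBrDr -!rmorphN -!rmorphD -!gi !g_lt.
by [].
Qed.

(** Maximality only provided an additive isomorphism. Multiplicativity follows from continuity: both
    sides are approximated by one and the same product of elements of [K]. *)
Lemma isoM c c' : g (c * c') = g c * g c'.
Proof.
have Mg x : M (g x) by apply/gM; exists x.
apply: (submodel_eq dM) => //; first exact: (tv_mul TV).
move=> r r0.
have [a ca ac] := dense_approx complC c (@ltr01 K).
have [a' ca' ac'] := dense_approx complC c' (@ltr01 K).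
pose B := `|a| + `|a'| + 1.
have bound x : c = x \/ c' = x -> `|x| < i B /\ `|g x| < d B.
  move=> hx; have [y [xy yx yB]] : exists y, [/\ x < i y, i (y - 1) < x & `|y| + 1 <= B].
    case: hx => <-; [exists a|exists a']; split=> //; rewrite /B lerD2r.
      by rewrite lerDl.
    by rewrite lerDr.
  have h : `|x - i 0| < i B.
    rewrite rmorph0 subr0 ltr_norml; apply/andP; split.
      rewrite -rmorphN; apply: le_lt_trans yx; rewrite i_mono.
      by have := ler_norm (- y); rewrite normrN; lra.
    by apply: lt_le_trans xy _; rewrite i_mono; have := ler_norm y; lra.
  have := iso_dist h; move: h; rewrite !rmorph0 !subr0; by split.
have B0 : 0 < B by rewrite /B; have := normr_ge0 a; have := normr_ge0 a'; lra.
(* A precision at most 1 for which the error [t * (2 * B + 1)] of [mul_approx] is below [r / 2]. *)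
pose t := r / (2 * (2 * B + 1) + r).
have t0 : 0 < t by rewrite divr_gt0 //; lra.
have t1 : t <= 1 by rewrite ler_pdivrMr; lra.
have tr : t * (2 * B + 1) < r / 2.
  rewrite /t mulrAC ltr_pdivrMr; last lra.
  have : 0 < r * r by rewrite mulr_gt0.
  lra.
have approx x : exists p, `|x - i p| < i t.
  have [p px xp] := dense_approx complC x t0; exists p.
  by move: xp; rewrite rmorphB ltr_norml; lra.
clearbody t B; have [p cp] := approx c; have [q cq] := approx c'.
have [cB gcB] := bound c (or_introl erefl).
have [cB' gcB'] := bound c' (or_intror erefl).
have h1 : `|c * c' - i (p * q)| < i (r / 2).
  apply: le_lt_trans (_ : i (t * (2 * B + 1)) < _); last first.
    by rewrite (leW_mono i_mono).
  rewrite !(rmorphM, rmorphD, rmorph1, rmorph_nat).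
  by apply: mul_approx; [exact: ltW|exact: ltW|exact: ltW|exact: ltW|rewrite -(rmorph1 i) i_mono].
have h2 : `|g c * g c' - d (p * q)| < d (r / 2).
  apply: le_lt_trans (_ : d (t * (2 * B + 1)) < _); last first.
    by rewrite (leW_mono d_mono).
  rewrite !(rmorphM, rmorphD, rmorph1, rmorph_nat).
  by apply: mul_approx; [exact: ltW|exact: ltW|exact: ltW (iso_dist cp)|
    exact: ltW (iso_dist cq)|rewrite -(rmorph1 d) d_mono].
rewrite -(subrKA (d (p * q))); apply: le_lt_trans (ler_normD _ _) _.
by rewrite (splitr r) rmorphD ltrD ?iso_dist // distrC.
Qed.

(** The structure is pulled back along [g]. Closure of [M] under the functions handles terms, and
    Tarski-Vaught handles quantifiers. *)
Lemma transport_expansion : exists eC : expansion L C, elementary_embedding e eC i.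
Proof.
have g_inj : injective g.
  by move=> x y E; case: (ltgtP x y) => //; rewrite -g_lt E ltxx.
have /boolp.choice[h hP] : forall y, exists c, M y -> g c = y.
  move=> y; have [/gM[c <-]|nM] := pselect (M y); first by exists c.
  by exists 0.
have Mg x : M (g x) by apply/gM; exists x.
pose eC : expansion L C := Expansion
  (fun f (v : 'I_(farity f) -> C) => h (finterp eN (fun k => g (v k))))
  (fun r (v : 'I_(rarity r) -> C) => rinterp eN (fun k => g (v k))).
have evalC n (v : 'I_n -> C) t : g (eval eC v t) = eval eN (g \o v) t.
  elim: t => [k| | |t1 IH1 t2 IH2|t1 IH1 t2 IH2|f ts IH] //=.
  - by rewrite -(rmorph0 i) gi rmorph0.
  - by rewrite -(rmorph1 i) gi rmorph1.
  - by rewrite gD IH1 IH2.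
  - by rewrite isoM IH1 IH2.
  rewrite hP; last by apply: (submodel_fun dM).
  by congr finterp; apply/funext => k; rewrite IH.
have satC n (phi : formula L n) : forall v : 'I_n -> C, sat eC v phi <-> sat eN (g \o v) phi.
  elim: n / phi => [n t1 t2|n t1 t2|n r ts|n phi IH|n phi1 IH1 phi2 IH2|n phi IH] v /=.
  - by rewrite -!evalC; split=> [->|/g_inj].
  - by rewrite -!evalC g_lt.
  - suff -> : (fun k => g (eval eC v (ts k))) = (fun k => eval eN (g \o v) (ts k)) by [].
    by apply/funext => k; rewrite evalC.
  - by rewrite IH.
  - by rewrite IH1 IH2.
  have E x : g \o env_cons x v = env_cons (g x) (g \o v).
    by apply/funext => k /=; case: (unliftP ord0 k) => [j|] ->; rewrite ?env_cons0 ?env_consS.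
  split=> [[x /IH hx]|[x hx]]; first by exists (g x); rewrite -E.
  have [y /gM[c <-] hc] := submodel_ex dM (fun k => Mg (v k)) hx.
  by exists c; apply/IH; rewrite E.
exists eC => n phi v; rewrite elem satC.
suff -> : d \o v = g \o (i \o v) by [].
by apply/funext => k /=; rewrite gi.
Qed.

End Transport.

Section Diag.
Variables (I : Type) (U : set_system I) (UU : UltraFilter U) (K : realFieldType).

Fact diag_zmod : zmod_morphism (@diag _ _ UU K : K -> ultrapower UU K).
Proof. by move=> x y; rewrite -[RHS]/(uadd _ (uopp _)) uoppE uaddE. Qed.

Fact diag_monoid : monoid_morphism (@diag _ _ UU K : K -> ultrapower UU K).
Proof. by split=> // x y; rewrite -[RHS]/(umul _ _) umulE. Qed.

HB.instance Definition _ :=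
  GRing.isZmodMorphism.Build K (ultrapower UU K) (@diag _ _ UU K) diag_zmod.
HB.instance Definition _ :=
  GRing.isMonoidMorphism.Build K (ultrapower UU K) (@diag _ _ UU K) diag_monoid.

Lemma diag_mono : {mono (@diag _ _ UU K : K -> ultrapower UU K) : x y / x <= y}.
Proof.
move=> x y; apply/uleP/idP => [/(ae_exists UU)[]//|xy].
exact: (aeW UU).
Qed.

End Diag.

(** The ultrapower is indexed by [K] itself, along an ultrafilter refining the right neighbourhoods
    of 0, so that the index plays the role of an arbitrarily small positive element. *)
Lemma completion_expansion (L : language) (K : realFieldType) (e : expansion L K)
    (C : realFieldType) (i : {rmorphism K -> C}) :
  d_minimal e -> is_cauchy_completion i ->
  exists eC : expansion L C, elementary_embedding e eC i.
Proof.
move=> dm complC.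
have [U [UU UE]] := ultraFilterLemma (at_right_proper_filter (0 : K)).
pose N := ultrapower UU K; pose eN := upower_expansion UU e.
pose d : {rmorphism K -> N} := @diag _ _ UU K.
have elem : elementary_embedding e eN d := diag_elementary UU e.
have equivN := elementary_embedding_equiv elem.
have [lubN _] := d_minimal_equiv dm equivN.
have rankN (K' : realFieldType) (e' : expansion L K') :
    elementarily_equivalent eN e' -> finite_rank e'.
  by move=> /(elementarily_equivalent_trans equivN)/(d_minimal_equiv dm)[].
have TV0 := tarski_vaught_range elem.
have [M [dM maxM]] := dense_submodel_max (@diag_mono _ _ UU K) TV0.
have [i_mono i_dense _] := complC.
have i_lt := leW_mono i_mono.
have realize c : exists s : N, near d i s c.
  (* [f r] approximates [c] to precision [r], and the class of [f] realizes the cut of [c]. *)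
  have /boolp.choice[f hf] : forall r, exists a, 0 < r -> `|c - i a| < i r.
    move=> r; have [r0|_] := ltP 0 r; last by exists 0.
    have [a ca ac] := dense_approx complC c r0; exists a.
    by move: ac; rewrite rmorphB ltr_norml; lra.
  have small r0 : 0 < r0 -> ae U (fun r => 0 < r /\ r < r0).
    move=> r00; apply: UE; near=> r; split; near: r.
      exact: nbhs_right_gt.
    exact: nbhs_right_lt.
  exists (cls UU f) => a; split=> ac.
    have [b /andP[+ bc]] := i_dense _ _ ac; rewrite i_lt => ab.
    have ba0 : 0 < b - a by rewrite subr_gt0.
    apply/cls_lt; apply: ae_imp (small _ ba0) => r [/hf + rb].
    rewrite ltr_norml -i_lt => h; move: rb; rewrite -i_lt rmorphB; lra.
  have [b /andP[cb]] := i_dense _ _ ac; rewrite i_lt => ba.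
  have ba0 : 0 < a - b by rewrite subr_gt0.
  apply/cls_lt; apply: ae_imp (small _ ba0) => r [/hf + rb].
  rewrite ltr_norml -i_lt => h; move: rb; rewrite -i_lt rmorphB; lra.
have [g [_ gM gi gD g_lt]] := submodel_iso lubN rankN (@diag_mono _ _ UU K) dM
  complC maxM realize.
exact: (transport_expansion (@diag_mono _ _ UU K) elem dM complC gM gi gD g_lt).
Unshelve. all: by end_near.
Qed.

(** * Uniqueness *)

Section Uniqueness.
Variables (L : language) (K C : realFieldType) (e : expansion L K).
Variables (i : {rmorphism K -> C}) (e1 e2 : expansion L C).
Hypotheses (dm : d_minimal e) (complC : is_cauchy_completion i).
Hypotheses (elem1 : elementary_embedding e e1 i) (elem2 : elementary_embedding e e2 i).

Let i_mono : {mono i : x y / x <= y}. Proof. by case: complC. Qed.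
Let i_dense : order_dense i. Proof. by case: complC. Qed.

(** The identity on [M] is a partial elementary map between the two expansions. *)
Definition agree (M : set C) := forall n (phi : formula L n) (w : 'I_n -> C),
  (forall k, M (w k)) -> sat e1 w phi <-> sat e2 w phi.

Lemma agree_max : exists M, [/\ range i `<=` M, agree M &
  forall M', M `<=` M' -> agree M' -> M' `<=` M].
Proof.
have agree_range : agree (range i).
  move=> n phi w hw.
  have /boolp.choice[v hv] : forall k, exists a, i a = w k.
    by move=> k; have [a _ <-] := hw k; exists a.
  have -> : w = i \o v by apply/funext => k; rewrite /= hv.
  by rewrite -elem1 elem2.
have [|M [PM maxM]] := @Zorn_bigcup C [set M | M = set0 \/ range i `<=` M /\ agree M].
  move=> F FP tF.
  have [[X0 [FX0 [iX0 _]]]|nF] := pselect (exists X, F X /\ (range i `<=` X /\ agree X));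
      last first.
    left; rewrite -subset0 => y [X FX Xy]; case: (FP _ FX) => [X0|dX].
      by move: Xy; rewrite X0.
    by case: nF; exists X.
  right; split; first by move=> y /iX0; exists X0.
  move=> n phi w hw.
  have [X FX Xw] : exists2 X, F X & forall a, a \in codom w -> X a.
    apply: (chain_seq (ex_intro _ X0 FX0) tF) => a /codomP[k ->]; exact: hw.
  case: (FP _ FX) => [XE|[_ agX]]; last by apply: agX => k; apply: Xw; apply: codom_f.
  (* The chain member may be empty, which is possible only for sentences; these are settled by the
     range of [i]. *)
  case: n phi w hw Xw => [|n] phi w hw Xw.
    by apply: agree_range => -[].
  by have := Xw (w ord0) (codom_f _ _); rewrite XE.
have [iM agM] : range i `<=` M /\ agree M.
  case: PM => // M0; exfalso; apply: (maxM (range i)); last by right; split.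
  by rewrite M0; split=> // /(_ (i 0)); apply; exists 0.
exists M; split=> // M' MM' agM'; apply: contrapT => h.
by apply: (maxM M'); [split|right; split=> //; apply: subset_trans iM MM'].
Qed.

Section Maximal.
Variable M : set C.
Hypotheses (iM : range i `<=` M) (agM : agree M).

Lemma agree_psat p x : params_in M p -> M x ->
  psat e1 id p (fun=> x) <-> psat e2 id p (fun=> x).
Proof.
by move=> pM Mx; apply: agM => k /=; case E: passign => [j|a] //=; apply: pM E.
Qed.

(** One implication suffices, negation giving the converse; every occurrence of [c] becomes a
    variable, read in the constant environment [c]. *)
Lemma agree_extend c :
  (forall p, params_in M p -> psat e1 id p (fun=> c) -> psat e2 id p (fun=> c)) ->
  agree (M `|` [set c]).
Proof.
move=> h n phi w hw.
pose p : pform L C := PForm phi (fun k => if pselect (w k = c) then inl 0%N else inr (w k)).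
have pM : params_in M p.
  by move=> k a /=; case: pselect => // nc [<-]; case: (hw k).
have pw : look id (fun=> c) \o @passign _ _ p = w.
  by apply/funext => k /=; case: pselect.
have E j : psat j id p (fun=> c) = sat j w phi by rewrite /psat pw.
split=> h1; first by rewrite -E; apply: h => //; rewrite E.
apply: contrapT => h2; have : psat e2 id (pnot p) (fun=> c) by apply: h => //; rewrite psat_not E.
by rewrite psat_not E.
Qed.

Let at0 (p : pform L C) : pform L C := psubst (fun=> inl 0%N) p.

Let psat_at0 e' p v : psat e' id (at0 p) v = psat e' id p (fun=> v 0%N).
Proof. by rewrite psat_subst. Qed.

Let params_at0 p : params_in M p -> params_in M (at0 p).
Proof. by move=> pM; apply: params_subst. Qed.

Let M0 : M 0. Proof. by apply: iM; exists 0; rewrite ?rmorph0. Qed.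

(** That [p] holds throughout the interval is itself a statement with parameters in [M]. *)
Lemma agree_forall a b p : M a -> M b -> params_in M p ->
  (forall x, a < x -> x < b -> psat e1 id p (fun=> x)) ->
  forall x, a < x -> x < b -> psat e2 id p (fun=> x).
Proof.
move=> Ma Mb pM h.
pose q := pnot (pex (pand (pand (plt L (inr a) (inl 0%N)) (plt L (inl 0%N) (inr b)))
  (pnot (at0 p)))).
have qM : params_in M q.
  apply: params_ex; apply: params_and; last exact: params_at0.
  by apply: params_and; apply: params_at2 => // _ [<-].
have qE e' : psat e' id q (fun=> 0) <->
    forall x, a < x -> x < b -> psat e' id p (fun=> x).
  rewrite psat_not psat_ex; split=> [h' x ax xb|h' [x]].
    apply: contrapT => npx; apply: h'; exists x.
    by rewrite !psat_and psat_not psat_at0 !psat_lt.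
  by rewrite !psat_and psat_not psat_at0 !psat_lt => -[[/= ax xb]]; apply; apply: h'.
by apply/qE; apply/(agree_psat qM M0)/qE.
Qed.

Hypothesis maxM : forall M', M `<=` M' -> agree M' -> M' `<=` M.

Let max_mem c : (forall p, params_in M p -> psat e1 id p (fun=> c) ->
  psat e2 id p (fun=> c)) -> M c.
Proof.
move=> /agree_extend agc; apply: (maxM _ agc); last by right.
by move=> x; left.
Qed.

(** Let [q] define [y] in [e1]. By agreement, in [e2] it has at most one solution, and any interval
    around [y] with ends in [K] contains a common solution of [q] and [p]. As [K] is dense, that
    solution can only be [y], which thus satisfies in [e2] whatever it satisfies in [e1]. *)
Lemma agree_dcl y : dcl e1 M y -> M y.
Proof.
move=> [q qM yq]; apply: max_mem => p pM py.
pose r := at0 (pand q p).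
have rM : params_in M r by apply: params_at0; apply: params_and.
have qy x : psat e1 id q (fun=> x) <-> x = y by rewrite -yq.
have near_y (a b : K) : i a < y -> y < i b -> exists x,
    [/\ i a < x, x < i b, psat e2 id q (fun=> x) & psat e2 id p (fun=> x)].
  move=> ay yb; apply: contrapT => h.
  have Mi c : M (i c) by apply: iM; exists c.
  have : psat e2 id (pex (pand (pand (plt L (inr (i a)) (inl 0%N))
      (plt L (inl 0%N) (inr (i b)))) r)) (fun=> 0).
    apply/agree_psat => //.
      apply: params_ex; apply: params_and => //.
      by apply: params_and; apply: params_at2 => // _ [<-].
    rewrite psat_ex; exists y; rewrite !psat_and psat_at0 psat_and !psat_lt.
    by do !split=> //; apply/qy.
  rewrite psat_ex => -[x]; rewrite !psat_and psat_at0 psat_and !psat_lt.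
  by move=> [[/= ax xb] [qx px]]; apply: h; exists x.
have uniq2 x x' : psat e2 id q (fun=> x) -> psat e2 id q (fun=> x') -> x < x' -> False.
  move=> qx qx' xx'.
  pose u := pnot (pex (pex (pand (plt L (inl 0%N) (inl 1%N))
    (pand (at0 q) (psubst (fun=> inl 1%N) q))))).
  have : psat e2 id u (fun=> 0).
    apply/agree_psat => //.
      apply: params_ex; apply: params_ex; apply: params_and; first exact: params_at2.
      by apply: params_and; apply: params_subst.
    rewrite psat_not !psat_ex => -[z']; rewrite psat_ex => -[z].
    rewrite !psat_and psat_at0 psat_subst psat_lt => -[/= zz' [/qy zy /qy zy']].
    by move: zy zy' zz' => /= -> ->; rewrite ltxx.
  rewrite psat_not psat_ex; apply; exists x'; rewrite psat_ex; exists x.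
  by rewrite !psat_and psat_at0 psat_subst psat_lt.
have [a /andP[_ ay]] : exists a, y - 1 < i a < y by apply: i_dense; lra.
have [b /andP[yb _]] : exists b, y < i b < y + 1 by apply: i_dense; lra.
have [x [ax xb qx px]] := near_y a b ay yb.
suff <- : x = y by [].
case: (ltgtP x y) => // xy; exfalso.
  have [a' /andP[xa' a'y]] := i_dense xy.
  have [x' [a'x' _ qx' _]] := near_y a' b a'y yb.
  by apply: (uniq2 x x') => //; apply: lt_trans a'x'.
have [b' /andP[yb' b'x]] := i_dense xy.
have [x' [_ x'b' qx' _]] := near_y a b' ay yb'.
by apply: (uniq2 x' x) => //; apply: lt_trans b'x.
Qed.

(** A point outside [M] makes a Cauchy cut, so a formula true of it in [e1] holds on an interval
    with ends in [M]. This transfers to [e2], and the point could be added to [M]. *)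
Lemma agree_full c : M c.
Proof.
have [lub1 rank1] := d_minimal_equiv dm (elementary_embedding_equiv elem1).
apply: contrapT => nMc.
have TV1 : tarski_vaught e1 M.
  move=> A dA nA; have [y Ay dy] := dcl_choice lub1 rank1 dA nA.
  by exists y => //; apply: agree_dcl.
have cutc : cauchy_cut M c.
  split=> [r _ r0|b Mb].
    have [|a /andP[ca ac]] := @i_dense c (c + r); first by lra.
    by exists (i a); [apply: iM; exists a|rewrite ltr_norml; lra].
  have cb : 0 < `|c - b|.
    by rewrite normr_gt0 subr_eq0; apply/eqP => cb; apply: nMc; rewrite cb.
  have [a /andP[a0 acb]] := i_dense cb.
  by exists (i a); split=> //; [apply: iM; exists a|apply: ltW].
apply: nMc; apply: max_mem => p pM pc.
have dA : Dset e1 M [set x | psat e1 id p (fun=> x)].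
  by exists (at0 p) => [|v]; [exact: params_at0|rewrite psat_at0].
have [a [b [Ma Mb ac cb hab]]] := cut_interval lub1 rank1 TV1 cutc dA pc.
exact: (agree_forall Ma Mb pM hab).
Qed.

End Maximal.

(** Agreement on atomic formulas recovers the interpretation of each symbol. *)
Lemma completion_expansion_unique : e1 = e2.
Proof.
have [M [iM agM maxM]] := agree_max.
have ag n (phi : formula L n) w : sat e1 w phi <-> sat e2 w phi.
  by apply: (agM n phi w) => k; apply: (agree_full iM agM maxM).
have fE f w : @finterp L C e1 f w = @finterp L C e2 f w.
  have := ag _ (FEq (TVar L ord0) (@TFun L _ f (fun k => TVar L (lift ord0 k))))
    (env_cons (@finterp L C e1 f w) w).
  rewrite /= env_cons0; under eq_fun do rewrite env_consS.
  by move=> [h _]; apply: h.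
have rE r w : @rinterp L C e1 r w = @rinterp L C e2 r w.
  by apply/propext; apply: (ag _ (@FRel L _ r (fun k => TVar L k)) w).
case: e1 e2 fE rE => f1 r1 [f2 r2] /= fE rE; congr Expansion.
  by apply: functional_extensionality_dep => f; apply/funext => w; apply: fE.
by apply: functional_extensionality_dep => r; apply/funext => w; apply: rE.
Qed.

End Uniqueness.

Theorem proposition6p7 (L : language) (K : realFieldType) (e : expansion L K)
    (C : realFieldType) (i : {rmorphism K -> C}) :
  d_minimal e -> is_cauchy_completion i ->
  exists! eC : expansion L C, elementary_embedding e eC i.
Proof.
move=> dm complC; have [eC elemC] := completion_expansion dm complC.
by exists eC; split=> // e'; apply: completion_expansion_unique.
Qed.
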